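(* Let $t$ be a non-negative real number other than $\gamma^-$ and $\gamma^+$, and denote $$ \Delta(t)=\max\biggl\{136,\;e^{6t^2}\frac{12+10t+7t^2+10t^3}{|1-24t^2+48t^4|}\biggr\}. $$ If $d$ is an integer at least $\Delta(t)$, then $I_{d+1}(t)-I_d(t)$ is positive when $0\leq t<\gamma^-$ or $\gamma^+<t$, and negative when $\gamma^-<t<\gamma^+$.
   Context: For a positive integer $d$ and a non-negative real number $t$, $I_d(t)$ denotes the $(d-1)$-dimensional volume of $H\cap[0,1]^d$ where $H$ is a hyperplane of $\mathbb{R}^d$ that is orthogonal to a diagonal of the hypercube $[0,1]^d$ (a segment joining two opposite vertices) and whose Euclidean distance to the center of $[0,1]^d$ is equal to $t$. By symmetry, this does not depend on the choice of such an $H$. The volume is $0$ when the intersection is empty. For $d\geq2$, one has $$ I_d(t)=\frac{2\sqrt{d}}{\pi}\int_{0}^{+\infty}\biggl(\frac{\sin u}{u}\biggr)^{d}\cos\bigl(2\sqrt{d}\,tu\bigr)\,du. $$ The numbers $\gamma^-$ and $\gamma^+$ are the two non-negative roots of $1-24t^2+48t^4$, namely $\gamma^\pm=\frac{1}{2}\sqrt{1\pm\sqrt{2/3}}$. *)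

(* Defs.v *)
From HB Require Import structures.
From mathcomp Require Import all_boot all_order all_algebra.
From mathcomp Require Import all_classical all_reals all_analysis.
Set Implicit Arguments.
Unset Strict Implicit.
Unset Printing Implicit Defensive.
Import Order.TTheory GRing.Theory Num.Theory.
Local Open Scope classical_set_scope.
Local Open Scope ring_scope.

Section cons_measure.
Context d (T : measurableType d) (R : realType) (n : nat).

Definition tuple_cons (p : T * n.-tuple T) : n.+1.-tuple T :=
  [tuple of p.1 :: p.2].

Lemma measurable_tuple_cons : measurable_fun [set: T * n.-tuple T] tuple_cons.
Proof. exact: (measurable_cons measurable_fst measurable_snd). Qed.

Variables (m1 : {sigma_finite_measure set T -> \bar R})
          (m : {sigma_finite_measure set (n.-tuple T) -> \bar R}).

Definition cons_measure : set (n.+1.-tuple T) -> \bar R :=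
  pushforward (m1 \x m)%E tuple_cons.

Let cons_measure0 : cons_measure set0 = 0%E.
Proof. exact: (measure0 (m1 \x m)%E). Qed.

Let cons_measure_ge0 A : (0 <= cons_measure A)%E.
Proof. exact: (measure_ge0 (m1 \x m)%E). Qed.

Let cons_measure_sigma_additive : semi_sigma_additive cons_measure.
Proof.
rewrite /cons_measure => F mF tF mUF; rewrite /pushforward preimage_bigcup.
have mpre B : measurable B -> measurable (tuple_cons @^-1` B).
  by move=> mB; rewrite -[X in measurable X]setTI; exact: measurable_tuple_cons.
apply: (@measure_semi_sigma_additive _ _ _ (m1 \x m)%E) => [i||].
- exact: mpre.
- apply/trivIsetP => i j _ _ ij; rewrite -preimage_setI.
  by move/trivIsetP : tF => /(_ i j I I ij) ->; rewrite preimage_set0.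
- by rewrite -preimage_bigcup; exact: mpre.
Qed.

HB.instance Definition _ := isMeasure.Build _ _ _ cons_measure
  cons_measure0 cons_measure_ge0 cons_measure_sigma_additive.

Lemma cons_measure_sigma_finite : sigma_finite setT cons_measure.
Proof.
have /sigma_finiteP[F [TF ndF Foo]] := sigma_finiteT m1.
have /sigma_finiteP[G [TG ndG Goo]] := sigma_finiteT m.
exists (fun k => (@thead n T) @^-1` F k `&`
                 (fun t : n.+1.-tuple T => [tuple of behead t]) @^-1` G k).
  rewrite predeqE => t; split=> // _.
  have [i _ Fi] : (\bigcup_k F k) (thead t) by rewrite -TF.
  have [j _ Gj] : (\bigcup_k G k) [tuple of behead t] by rewrite -TG.
  exists (maxn i j) => //; split.
  - by move/subsetPset : (ndF _ _ (leq_maxl i j)); exact.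
  - by move/subsetPset : (ndG _ _ (leq_maxr i j)); exact.
move=> k; have [mF Fk] := Foo k; have [mG Gk] := Goo k; split.
  apply: measurableI.
    by rewrite -[X in measurable X]setTI; exact: measurable_tnth.
  by rewrite -[X in measurable X]setTI; exact: measurable_behead.
rewrite /cons_measure /pushforward (_ : _ @^-1` _ = F k `*` G k).
  by rewrite product_measure1E// lte_mul_pinfty// ge0_fin_numE.
rewrite predeqE => -[x t] /=; rewrite theadE (_ : [tuple of _] = t)//.
exact/val_inj.
Qed.

HB.instance Definition _ :=
  Measure_isSigmaFinite.Build _ _ _ cons_measure cons_measure_sigma_finite.

End cons_measure.

(* The n-fold product of the Lebesgue measure, i.e., Lebesgue measure on R^n. *)
Fixpoint lebesgue_tuple {R : realType} (n : nat) :
    {sigma_finite_measure set (n.-tuple (measurableTypeR R)) -> \bar R} :=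
  match n with
  | 0 => \d_([tuple] : 0.-tuple (measurableTypeR R))
  | n'.+1 => cons_measure (@lebesgue_measure R) (lebesgue_tuple n')
  end.

Section section_volume.
Context {R : realType}.
Implicit Types (d k : nat) (t : R).

Definition dotv d (u v : 'rV[R]_d) : R := (u *m v^T) 0 0.

(* The Euclidean norm; the library norm on matrices is the sup norm. *)
Definition enorm d (u : 'rV[R]_d) : R := Num.sqrt (dotv u u).

Definition cube d : set 'rV[R]_d := [set x | forall i, 0 <= x 0 i <= 1].

Definition cube_vertex d (v : 'rV[R]_d) : Prop :=
  forall i, v 0 i = 0 \/ v 0 i = 1.

Definition opposite_vertices d (v w : 'rV[R]_d) : Prop :=
  cube_vertex v /\ w = const_mx 1 - v.

Definition cube_center d : 'rV[R]_d := const_mx 2^-1.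

Definition diagonal_hyperplane d t (H : set 'rV[R]_d) : Prop :=
  (exists v w q, opposite_vertices v w /\
     H = [set x | dotv (x - q) (w - v) = 0]) /\
  inf [set enorm (x - cube_center d) | x in H] = t.

(* f identifies the Euclidean space R^k isometrically with H. *)
Definition isometric_chart k d (H : set 'rV[R]_d)
    (f : k.-tuple (measurableTypeR R) -> 'rV[R]_d) : Prop :=
  (forall y z,
     enorm (f y - f z) = enorm (\row_(i < k) (tnth y i - tnth z i : R))) /\
  range f = H.

(* The k-dimensional volume of a subset S of a k-dimensional affine subspace H
   is its Lebesgue measure after an isometric identification of H with R^k. *)
Definition is_flat_volume k d (H S : set 'rV[R]_d) (v : \bar R) : Prop :=
  exists2 f : k.-tuple (measurableTypeR R) -> 'rV[R]_d,
    isometric_chart H f & v = lebesgue_tuple k (f @^-1` S).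

Definition is_section_volume d t (v : R) : Prop :=
  exists2 H, diagonal_hyperplane t H &
    is_flat_volume d.-1 H (H `&` @cube d) v%:E.

(* For 0 < d and 0 <= t exactly one real number satisfies the predicate: the
   volume does not depend on the choice of the hyperplane or of the chart. *)
Definition section_volume d t : R := xget 0 (is_section_volume d t).

Definition gamma_minus : R := 2^-1 * Num.sqrt (1 - Num.sqrt (2 / 3)).

Definition gamma_plus : R := 2^-1 * Num.sqrt (1 + Num.sqrt (2 / 3)).

Definition Delta t : R :=
  Num.max 136
    (expR (6 * t ^+ 2) * ((12 + 10 * t + 7 * t ^+ 2 + 10 * t ^+ 3)
                          / `|1 - 24 * t ^+ 2 + 48 * t ^+ 4|)).

End section_volume.

(* Main.v *)
Require Import Defs.
From HB Require Import structures.
From mathcomp Require Import all_boot all_order all_algebra.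
From mathcomp Require Import all_classical all_reals all_analysis.
From mathcomp Require Import measurable_realfun.
From mathcomp Require Import ring lra.
Set Implicit Arguments.
Unset Strict Implicit.
Unset Printing Implicit Defensive.
Import Order.TTheory GRing.Theory Num.Theory.
Import numFieldNormedType.Exports.
Local Open Scope classical_set_scope.
Local Open Scope ring_scope.

(** Slicing the d-space along the normal of the hyperplane, and along a coordinate
    axis, shows that the section volume is sqrt d times the measure of the points y
    of the (d-1)-cube with |s - sum_i e_i (y_i - 1/2)| <= 1/2, where e_i = 1 or -1
    and |s| = sqrt d * t, whatever the isometric chart. This only requires the
    invariance of the Lebesgue measure under isometries, which holds because
    translation-invariant measures are proportional and isometries preserve balls.
    That measure is a d-fold convolution of indicator functions of intervals; its
    Fourier representation, by induction from d = 2, reads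
      I_d(t) = 2/pi int_0^oo (sin x / x)^d cos(2tv) dv  with  x = v / sqrt d.
    For x <= 1, sin x / x = exp(- x^2/6 - x^4/180 - x^6/2835 - r) with r of order
    x^8, hence consecutive integrands differ by e^(-v^2/6) v^4 / (180 d (d+1)) up to
    a term of order d^-3, and the contribution of x > 1 is exponentially small. The
    main term integrates to
      27 (1 - 24t^2 + 48t^4) e^(-6t^2) G / (180 d (d+1)),  G = int_0^oo e^(-v^2/6) dv,
    and comparing Gaussian moments bounds the error by (9/5) G / (d^2 (d+1)), which
    is at most the size of the main term as soon as d >= Delta(t). *)

(** * Lebesgue measure on tuples: slicing and translations *)

(** The variable v = sqrt d u gives every integrand the same leading factor e^(-v^2/6), so it
    cancels in the difference of consecutive dimensions and the fourth order term of - ln (sin x /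
    x) decides the sign. The cosine transform of v^4 e^(-v^2/6) is a degree 4 Hermite polynomial
    times a Gaussian, hence the quartic in t. Two obstacles shape the proof. The volume is chosen
    among all admissible hyperplanes and charts, so every choice must be shown to give one value,
    and some choice must exist. And sin x / x is not absolutely integrable: Fubini only applies from
    its square on, whose transform comes from the integral of (1 - cos (a v)) / v^2. The threshold
    136 acts three times: it keeps the exponent correction small against 1, it gives x^2 >= 136/137
    in the tail and hence a fixed ratio 27/32, and it makes (n+1)^4 (27/32)^(n-2) small. The
    integral G of the Gaussian is never evaluated: it scales the main term and the moment errors
    alike, and a lower bound for it absorbs the tail. *)

Lemma measurable_preimageT d1 d2 (T1 : measurableType d1) (T2 : measurableType d2)
  (f : T1 -> T2) (A : set T2) :
  measurable_fun setT f -> measurable A -> measurable (f @^-1` A).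
Proof. by move=> mf mA; rewrite -[X in measurable X]setTI; exact: mf. Qed.

Section translation.
Context {R : realType}.
Local Notation leb := (@lebesgue_measure R).
Local Notation TR := (measurableTypeR R).
Local Notation mu := (@lebesgue_tuple R).

Lemma lebesgue_measure_shift (a : R) (A : set TR) : measurable A ->
  leb ((fun x => x + a) @^-1` A) = leb A.
Proof.
move=> mA.
have mf : measurable_fun [set: TR] (fun x : TR => x + a : TR).
  exact: measurable_funD.
pose nu : {measure set TR -> \bar R} :=
  measure_function_pushforward__canonical__measure_function_Measure leb mf.
rewrite -[LHS]/(nu A); apply/esym/lebesgue_measure_unique => // _ [[x y] _ <-].
rewrite -[RHS]/(leb ((fun z => z + a) @^-1` `]x, y]%classic)).
have -> : (fun z => z + a) @^-1` `]x, y]%classic = `]x - a, y - a]%classic.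
  by apply/seteqP; split=> z /=; rewrite !in_itv/= ltrBlDr lerBrDr.
rewrite !lebesgue_measure_itv/= !lte_fin ltrD2r; case: ifP => // _.
by rewrite -!EFinB opprB addrA subrK.
Qed.

Definition tadd n (x y : n.-tuple TR) : n.-tuple TR :=
  [tuple (tnth x i + tnth y i : R) | i < n].

Definition topp n (x : n.-tuple TR) : n.-tuple TR :=
  [tuple (- tnth x i : R) | i < n].

Lemma tnth_tadd n (x y : n.-tuple TR) i : tnth (tadd x y) i = tnth x i + tnth y i.
Proof. by rewrite tnth_mktuple. Qed.

Lemma tnth_topp n (x : n.-tuple TR) i : tnth (topp x) i = - tnth x i.
Proof. by rewrite tnth_mktuple. Qed.

Definition tupE := (tnth_tadd, tnth_topp).

Lemma measurable_tadd d (T : measurableType d) n (f g : T -> n.-tuple TR) :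
  measurable_fun setT f -> measurable_fun setT g ->
  measurable_fun setT (fun x => tadd (f x) (g x)).
Proof.
move=> mf mg; apply/measurable_fun_tnthP => i.
rewrite (_ : _ \o _ = fun x => tnth (f x) i + tnth (g x) i); last first.
  by apply/funext => x /=; rewrite tnth_tadd.
by apply: measurable_funD; [move/measurable_fun_tnthP : mf|move/measurable_fun_tnthP : mg]; exact.
Qed.

Lemma measurable_topp d (T : measurableType d) n (f : T -> n.-tuple TR) :
  measurable_fun setT f -> measurable_fun setT (fun x => topp (f x)).
Proof.
move=> mf; apply/measurable_fun_tnthP => i.
rewrite (_ : _ \o _ = fun x => - (tnth (f x) i : R)); last first.
  by apply/funext => x /=; rewrite tnth_topp.
by apply: measurableT_comp => //; move/measurable_fun_tnthP : mf; exact.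
Qed.

Lemma lebesgue_tupleS n (A : set (n.+1.-tuple TR)) : 
  mu n.+1 A = (\int[leb]_x mu n [set y | A (tuple_cons (x, y))])%E.
Proof.
rewrite /= /cons_measure /pushforward /product_measure1.
apply: eq_integral => x _ /=; congr (_ _ _).
by apply/seteqP; split=> y; rewrite /xsection /= inE.
Qed.

Lemma lebesgue_tupleS_swap n (A : set (n.+1.-tuple TR)) : measurable A ->
  mu n.+1 A = (\int[mu n]_y leb [set x | A (tuple_cons (x, y))])%E.
Proof.
move=> mA; have mB : measurable (@tuple_cons _ TR n @^-1` A).
  by apply: measurable_preimageT => //; exact: measurable_tuple_cons.
rewrite lebesgue_tupleS.
have := indic_fubini_tonelli leb (mu n) mB.
rewrite indic_fubini_tonelli_FE// indic_fubini_tonelli_GE// => E.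
transitivity (\int[leb]_x ((mu n) \o xsection (@tuple_cons _ TR n @^-1` A)) x)%E.
  apply: eq_integral => x _ /=; congr (_ _ _).
  by apply/seteqP; split=> y; rewrite /xsection /= inE.
rewrite E; apply: eq_integral => x _ /=; congr (_ _).
by apply/seteqP; split=> y; rewrite /ysection /= inE.
Qed.

Lemma tnth_tuple_cons0 n (x : TR) (y : n.-tuple TR) :
  tnth (tuple_cons (x, y)) ord0 = x.
Proof. by []. Qed.

Lemma tnth_tuple_consS n (x : TR) (y : n.-tuple TR) i :
  tnth (tuple_cons (x, y)) (lift ord0 i) = tnth y i.
Proof. by rewrite tnthS. Qed.

Lemma tuple_cons_eta n (x : n.+1.-tuple TR) :
  x = tuple_cons (tnth x ord0, [tuple of behead x]).
Proof.
by case/tupleP: x => a t; apply: val_inj.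
Qed.

Lemma tadd_cons n (x a : TR) (y b : n.-tuple TR) :
  tadd (tuple_cons (x, y)) (tuple_cons (a, b)) = tuple_cons ((x + a : R), tadd y b).
Proof.
apply/eq_from_tnth => i; rewrite tnth_tadd; case: (unliftP ord0 i) => [j|] ->.
  by rewrite !tnth_tuple_consS tnth_tadd.
by rewrite !tnth_tuple_cons0.
Qed.

Lemma ge0_integral_shift (a : R) (f : TR -> \bar R) :
  measurable_fun setT f -> (forall x, 0 <= f x)%E ->
  (\int[leb]_x f ((x : R) + a)%R = \int[leb]_x f x)%E.
Proof.
move=> mf f0.
have ma : measurable_fun [set: TR] (fun x : TR => x + a : TR).
  exact: measurable_funD.
have := @ge0_integral_pushforward _ _ _ _ R _ ma leb setT f measurableT mf.
rewrite preimage_setT => <-//.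
apply: eq_measure_integral => A mA _.
exact: (lebesgue_measure_shift a mA).
Qed.

Lemma lebesgue_tuple_shift n (a : n.-tuple TR) (A : set (n.-tuple TR)) :
  measurable A -> mu n ((fun x => tadd x a) @^-1` A) = mu n A.
Proof.
elim: n a A => [|n IH] a A mA.
  congr (_ _); apply/seteqP; split=> x /=; first by rewrite (tuple0 (tadd _ _)) (tuple0 x).
  by rewrite (tuple0 (tadd _ _)) (tuple0 x).
have mS : measurable_fun [set: TR] (fun x : TR => mu n [set y | A (tuple_cons (x, y))]).
  have mB : measurable (@tuple_cons _ TR n @^-1` A).
    by apply: measurable_preimageT => //; exact: measurable_tuple_cons.
  rewrite (_ : (fun _ => _) = (mu n \o xsection (@tuple_cons _ TR n @^-1` A))).
    exact: measurable_fun_xsection.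
  apply/funext => x /=; congr (_ _ _).
  by apply/seteqP; split=> y; rewrite /xsection /= inE.
have mx (x : TR) : measurable [set y | A (tuple_cons (x, y))].
  have : measurable_fun [set: n.-tuple TR] (fun y => tuple_cons (x, y)).
    exact: (@measurable_cons _ _ (n.-tuple TR) TR (fun=> x) n (fun y => y)).
  by move/measurable_preimageT; exact.
rewrite [RHS]lebesgue_tupleS lebesgue_tupleS.
have <- := ge0_integral_shift (tnth a ord0) mS (fun _ => measure_ge0 _ _).
apply: eq_integral => x _; rewrite -[RHS](IH [tuple of behead a]) //.
have E y : tadd (tuple_cons (x, y)) a =
    tuple_cons ((x + tnth a ord0 : R), tadd y [tuple of behead a]).
  by rewrite -tadd_cons -tuple_cons_eta.
apply: (congr1 (mu n)); apply/funext => y; exact: (congr1 A (E y)).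
Qed.

End translation.

(** * Uniqueness of translation-invariant measures *)

Section haar.
Context {R : realType}.
Local Notation TR := (measurableTypeR R).
Local Notation mu := (@lebesgue_tuple R).
Local Open Scope ereal_scope.

Lemma tonelli_set d1 d2 (T1 : measurableType d1) (T2 : measurableType d2)
    (m1 : {sigma_finite_measure set T1 -> \bar R})
    (m2 : {sigma_finite_measure set T2 -> \bar R}) (E : set (T1 * T2)) :
  measurable E ->
  \int[m1]_x m2 [set y | E (x, y)] = \int[m2]_y m1 [set x | E (x, y)].
Proof.
move=> mE; have := indic_fubini_tonelli m1 m2 mE.
rewrite indic_fubini_tonelli_FE// indic_fubini_tonelli_GE// => {}EE.
transitivity (\int[m1]_x (m2 \o xsection E) x).
  apply: eq_integral => x _ /=; congr (m2 _).
  by apply/seteqP; split=> y; rewrite /xsection /= inE.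
rewrite EE; apply: eq_integral => x _ /=; congr (m1 _).
by apply/seteqP; split=> y; rewrite /ysection /= inE.
Qed.

Lemma integral_cst_restrict d1 d2 (T1 : measurableType d1) (T2 : measurableType d2)
    (m1 : {measure set T1 -> \bar R}) (m2 : {measure set T2 -> \bar R})
    (A : set T1) (P : T1 -> T2 -> Prop) (c : \bar R) :
  measurable A ->
  (forall x, A x -> m2 [set y | P x y] = c) ->
  \int[m1]_x m2 [set y | A x /\ P x y] = c * m1 A.
Proof.
move=> mA AP; rewrite -integral_cst// [RHS]integral_mkcond.
apply: eq_integral => x _; rewrite patchE.
case: ifPn => [|]; rewrite (inE, notin_setE) => Ax; last first.
  by rewrite (_ : [set y | _] = set0) ?measure0// -subset0 => y [].
by rewrite -(AP _ Ax); congr (m2 _); apply/seteqP; split=> y /=; [case|split].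
Qed.

(* Tonelli for the set of pairs (x, y) with x in A and x + F y in B: this is the
   uniqueness argument for translation-invariant measures, applied to the image
   of the Lebesgue measure under F. *)
Lemma haar_exchange n (F : n.-tuple TR -> n.-tuple TR) (A B : set (n.-tuple TR)) :
  measurable_fun setT F ->
  (forall x, exists a, forall y, F (tadd y a) = tadd (F y) x) ->
  measurable A -> measurable B ->
  mu n (F @^-1` B) * mu n A = mu n (F @^-1` (@topp R n @^-1` A)) * mu n B.
Proof.
move=> mF hF mA mB.
have mFB : measurable (F @^-1` B) by exact: measurable_preimageT.
have mFA : measurable (F @^-1` (@topp R n @^-1` A)).
  apply: measurable_preimageT => //; apply: measurable_preimageT => //.
  exact: (@measurable_topp R _ _ n (fun x => x)).
have mF2 : measurable_fun setT (fun z : n.-tuple TR * n.-tuple TR => F z.2).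
  exact: measurableT_comp.
pose E1 := [set z : n.-tuple TR * n.-tuple TR | A z.1 /\ B (tadd z.1 (F z.2))].
pose E2 := [set z : n.-tuple TR * n.-tuple TR | B z.1 /\ A (tadd z.1 (topp (F z.2)))].
have mE1 : measurable E1.
  apply: measurableI; first exact: measurable_preimageT measurable_fst mA.
  by apply: measurable_preimageT mB; exact: measurable_tadd.
have mE2 : measurable E2.
  apply: measurableI; first exact: measurable_preimageT measurable_fst mB.
  by apply: measurable_preimageT mA; apply: measurable_tadd => //; exact: measurable_topp.
transitivity (\int[mu n]_x mu n [set y | E1 (x, y)]).
  rewrite (@integral_cst_restrict _ _ _ _ (mu n) (mu n) A (fun x y => B (tadd x (F y))) (mu n (F @^-1` B)))//.
  move=> x _; have [a ha] := hF x.
  rewrite -[RHS](lebesgue_tuple_shift a)//; congr (mu n _).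
  apply/seteqP; split=> y /=; rewrite ha (_ : tadd x _ = tadd (F y) x)//;
    by apply: eq_from_tnth => i; rewrite !tupE addrC.
transitivity (\int[mu n]_x mu n [set y | E2 (x, y)]); last first.
  rewrite (@integral_cst_restrict _ _ _ _ (mu n) (mu n) B (fun x y => A (tadd x (topp (F y))))
    (mu n (F @^-1` (@topp R n @^-1` A))))//.
  move=> x _; have [a ha] := hF (topp x).
  rewrite -[RHS](lebesgue_tuple_shift a)//; congr (mu n _).
  apply/seteqP; split=> y /=; rewrite ha (_ : tadd x _ = topp (tadd (F y) (topp x)))//;
    by apply: eq_from_tnth => i; rewrite !tupE opprD opprK addrC.
(* With y fixed, translating x by [F y] turns the slice of [E2] into that of [E1]. *)
rewrite !tonelli_set//; apply: eq_integral => y _.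
rewrite -[RHS](lebesgue_tuple_shift (F y)); last first.
  have : measurable_fun [set: n.-tuple TR] (fun x : n.-tuple TR => (x, y)).
    exact: measurable_pair2.
  by move/measurable_preimageT; exact.
congr (mu n _); apply/seteqP; split=> x /=; rewrite /E1 /E2/=.
  move=> [Ax Bx]; split=> //; rewrite (_ : tadd _ _ = x)//.
  by apply: eq_from_tnth => i; rewrite !tupE addrK.
move=> [Bx]; rewrite (_ : tadd (tadd _ _) _ = x)//.
by apply: eq_from_tnth => i; rewrite !tupE addrK.
Qed.

End haar.

(** * Isometries *)

Section dot_product.
Context {R : realType}.
Implicit Types n k d : nat.

Lemma dotvE n (u v : 'rV[R]_n) : dotv u v = \sum_i u 0 i * v 0 i.
Proof. by rewrite /dotv mxE; apply: eq_bigr => i _; rewrite mxE. Qed.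

Lemma dotvC n (u v : 'rV[R]_n) : dotv u v = dotv v u.
Proof. by rewrite !dotvE; apply: eq_bigr => i _; rewrite mulrC. Qed.

Lemma dotvDl n (u v w : 'rV[R]_n) : dotv (u + v) w = dotv u w + dotv v w.
Proof. by rewrite /dotv mulmxDl mxE. Qed.

Lemma dotvZl n a (u v : 'rV[R]_n) : dotv (a *: u) v = a * dotv u v.
Proof. by rewrite /dotv -scalemxAl mxE. Qed.

Lemma dotvNl n (u v : 'rV[R]_n) : dotv (- u) v = - dotv u v.
Proof. by rewrite -scaleN1r dotvZl mulN1r. Qed.

Lemma dotvBl n (u v w : 'rV[R]_n) : dotv (u - v) w = dotv u w - dotv v w.
Proof. by rewrite dotvDl dotvNl. Qed.

Lemma dotvDr n (u v w : 'rV[R]_n) : dotv w (u + v) = dotv w u + dotv w v.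
Proof. by rewrite dotvC dotvDl !(dotvC w). Qed.

Lemma dotvZr n a (u v : 'rV[R]_n) : dotv u (a *: v) = a * dotv u v.
Proof. by rewrite dotvC dotvZl dotvC. Qed.

Lemma dotvBr n (u v w : 'rV[R]_n) : dotv w (u - v) = dotv w u - dotv w v.
Proof. by rewrite dotvC dotvBl !(dotvC w). Qed.

Definition dotv_lin := (dotvBl, dotvBr, dotvDl, dotvDr, dotvZl, dotvZr).

Lemma dotv_ge0 n (u : 'rV[R]_n) : 0 <= dotv u u.
Proof. by rewrite dotvE sumr_ge0// => i _; rewrite -expr2 sqr_ge0. Qed.

Lemma dotv_eq0 n (u : 'rV[R]_n) : dotv u u = 0 -> u = 0.
Proof.
rewrite dotvE => /psumr_eq0P u0; apply/rowP => i; rewrite mxE.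
have /eqP := u0 (fun i _ => ltac:(by rewrite -expr2 sqr_ge0)) i isT.
by rewrite mulf_eq0 orbb => /eqP.
Qed.

Lemma enorm_inj n k (u : 'rV[R]_n) (v : 'rV[R]_k) :
  enorm u = enorm v <-> dotv u u = dotv v v.
Proof.
split=> [|uv]; last by rewrite /enorm uv.
by move/(congr1 (fun x => x ^+ 2)); rewrite !sqr_sqrtr ?dotv_ge0.
Qed.

Definition isometric k n (F : 'rV[R]_k -> 'rV[R]_n) : Prop :=
  forall x y, dotv (F x - F y) (F x - F y) = dotv (x - y) (x - y).

Lemma isometric_dotv k n (F : 'rV[R]_k -> 'rV[R]_n) : isometric F ->
  forall x y, dotv (F x - F 0) (F y - F 0) = dotv x y.
Proof.
move=> iF x y.
have := iF x 0; have := iF y 0; have := iF x y; rewrite !subr0.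
rewrite (_ : F x - F y = (F x - F 0) - (F y - F 0)); last first.
  by rewrite opprB addrA subrK.
move: (F x - F 0) (F y - F 0) => u v.
by rewrite !dotv_lin (dotvC v u) (dotvC y x) => h1 h2 h3; lra.
Qed.

(** Inner products of differences from [F 0] are preserved, so the defect of affinity is orthogonal
    to every [L v]; being itself a combination of such vectors, it is orthogonal to itself. *)
Lemma isometric_affine k n (F : 'rV[R]_k -> 'rV[R]_n) : isometric F ->
  forall x a y, F (x + a *: y) = F x + a *: (F y - F 0).
Proof.
move=> iF x a y; have FE := isometric_dotv iF.
pose L u := F u - F 0.
pose z := L (x + a *: y) - L x - a *: L y.
have zL v : dotv z (L v) = 0.
  by rewrite /z 2!dotvBl dotvZl !FE !dotv_lin; lra.
have /dotv_eq0 z0 : dotv z z = 0.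
  by rewrite {2}/z 2!dotvBr dotvZr !zL; lra.
apply/eqP; rewrite -subr_eq0 -z0 /z /L; apply/eqP.
by apply/rowP => i; rewrite !mxE; lra.
Qed.

(** The coordinates of an isometry are affine functions of the coordinates, which is what makes
    charts measurable. *)
Lemma isometric_sum k n (F : 'rV[R]_k -> 'rV[R]_n) : isometric F ->
  forall x i, F x 0 i = F 0 0 i +
    \sum_j x 0 j * (F (delta_mx 0 j) 0 i - F 0 0 i).
Proof.
move=> iF x i.
have : F (\sum_j x 0 j *: delta_mx 0 j) =
    F 0 + \sum_j x 0 j *: (F (delta_mx 0 j) - F 0).
  elim/big_rec2: _ => [|j u v _ Fv]; first by rewrite addr0.
  by rewrite addrC isometric_affine// Fv -addrA [X in _ + X]addrC.
rewrite -row_sum_delta => /(congr1 (fun u : 'rV_n => u 0 i)) ->.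
by rewrite !mxE summxE; congr (_ + _); apply: eq_bigr => j _; rewrite !mxE.
Qed.

End dot_product.

Section tuple_vectors.
Context {R : realType}.
Local Notation TR := (measurableTypeR R).
Local Notation mu := (@lebesgue_tuple R).

(* The measure lives on tuples and the Euclidean structure on row vectors. *)
Definition tv n (x : n.-tuple TR) : 'rV[R]_n := \row_i (tnth x i : R).

Definition vt n (u : 'rV[R]_n) : n.-tuple TR := [tuple (u 0 i : TR) | i < n].

Lemma tvK n : cancel (@tv n) (@vt n).
Proof. by move=> x; apply: eq_from_tnth => i; rewrite tnth_mktuple mxE. Qed.

Lemma vtK n : cancel (@vt n) (@tv n).
Proof. by move=> u; apply/rowP => i; rewrite mxE tnth_mktuple. Qed.

Lemma tvD n (x y : n.-tuple TR) : tv (tadd x y) = tv x + tv y.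
Proof. by apply/rowP => i; rewrite !mxE tnth_tadd. Qed.

Lemma tvN n (x : n.-tuple TR) : tv (topp x) = - tv x.
Proof. by apply/rowP => i; rewrite !mxE tnth_topp. Qed.

Definition tiso k n (f : k.-tuple TR -> 'rV[R]_n) : Prop :=
  forall x y, dotv (f x - f y) (f x - f y) = dotv (tv x - tv y) (tv x - tv y).

Lemma tiso_isometric k n (f : k.-tuple TR -> 'rV[R]_n) :
  tiso f -> isometric (f \o @vt k).
Proof. by move=> fi x y /=; rewrite fi !vtK. Qed.

Lemma measurable_tv n i : measurable_fun [set: n.-tuple TR] (fun x => tv x 0 i).
Proof.
rewrite (_ : (fun _ => _) = @tnth _ TR ^~ i); first exact: measurable_tnth.
by apply/funext => x; rewrite mxE.
Qed.

Lemma measurable_tiso k n (f : k.-tuple TR -> 'rV[R]_n) : tiso f ->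
  forall i, measurable_fun setT (fun x => f x 0 i : R).
Proof.
move=> /tiso_isometric fi i.
rewrite (_ : (fun _ => _) = (fun x => f (vt 0) 0 i +
    \sum_(j < k) tv x 0 j * (f (vt (delta_mx 0 j)) 0 i - f (vt 0) 0 i))); last first.
  by apply/funext => x; rewrite -{1}(tvK x) [LHS](isometric_sum fi).
apply: measurable_funD => //; apply: measurable_sum => j.
by apply: measurable_funM => //; exact: measurable_tv.
Qed.

Lemma measurable_dotv d (T : measurableType d) n (f g : T -> 'rV[R]_n) :
  (forall i, measurable_fun setT (fun x => f x 0 i : R)) ->
  (forall i, measurable_fun setT (fun x => g x 0 i : R)) ->
  measurable_fun setT (fun x => dotv (f x) (g x)).
Proof.
move=> mf mg; under eq_fun do rewrite dotvE.
by apply: measurable_sum => i; exact: measurable_funM.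
Qed.

End tuple_vectors.

(** * Invariance of the Lebesgue measure under isometries *)

Section isometry_invariance.
Context {R : realType}.
Local Notation leb := (@lebesgue_measure R).
Local Notation TR := (measurableTypeR R).
Local Notation mu := (@lebesgue_tuple R).

Lemma lebesgue_tuple_cube n (a b : R) : a <= b ->
  mu n [set x | forall i, a <= tnth x i <= b] = ((b - a) ^+ n)%:E.
Proof.
move=> ab; elim: n => [|n IH].
  rewrite /= diracE mem_set//= => i; by case: i.
rewrite lebesgue_tupleS.
rewrite (_ : (fun _ => _) = ((cst ((b - a) ^+ n)%:E) \_ `[a, b]%classic)).
  rewrite -integral_mkcond integral_cst//= lebesgue_measure_itv/= lte_fin.
  case: ltgtP ab => // [ab _|-> _].
    by rewrite -EFinB -EFinM exprSr.
  by rewrite mule0 subrr expr0n.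
apply/funext => x; rewrite patchE /=.
case: ifPn => [|]; rewrite (inE, notin_setE)/= in_itv/= => xab.
  rewrite -IH; congr (mu n _); apply/seteqP; split=> y /= hy i.
    by have := hy (lift ord0 i); rewrite tnth_tuple_consS.
  by case: (unliftP ord0 i) => [j|] ->; rewrite ?tnth_tuple_consS.
rewrite (_ : [set y | _] = set0) ?measure0// -subset0 => y /= /(_ ord0).
by rewrite tnth_tuple_cons0.
Qed.

Lemma measurable_tcube n (a b : R) :
  measurable [set x : n.-tuple TR | forall i, a <= tnth x i <= b].
Proof.
rewrite (_ : [set _ | _] = \bigcap_(i in [set: 'I_n])
    ((@tnth _ TR) ^~ i @^-1` `[a, b]%classic)).
  apply: fin_bigcap_measurable => // i _; apply: measurable_preimageT => //.
  exact: measurable_tnth.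
apply/seteqP; split=> x /= h i.
  by move=> _ /=; rewrite in_itv /=; exact: h.
by have := h i Logic.I; rewrite /= in_itv.
Qed.

(** Test set that fixes the proportionality constant: its preimage under a surjective isometry is a
    translate of it, and its measure is finite and positive, so it cancels. *)
Definition unit_tball n : set (n.-tuple TR) := [set x | dotv (tv x) (tv x) <= 1].
Arguments unit_tball : clear implicits.

Lemma measurable_unit_tball n : measurable (unit_tball n).
Proof.
rewrite (_ : unit_tball n = (fun x => dotv (tv x) (tv x)) @^-1` `]-oo, 1]%classic).
  apply: measurable_preimageT => //.
  by apply: measurable_dotv => i; exact: measurable_tv.
by apply/seteqP; split=> x /=; rewrite in_itv.
Qed.

Lemma unit_tball_fin n : mu n (unit_tball n) \is a fin_num.
Proof.
rewrite ge0_fin_numE; last exact: measure_ge0.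
have mC := @measurable_tcube n (-1) (1).
apply: (@le_lt_trans _ _ (mu n [set x | forall i, -1 <= tnth x i <= 1])).
  apply: le_measure; rewrite ?inE//; first exact: measurable_unit_tball.
  move=> x /=; rewrite /unit_tball/= dotvE => x1 i.
  rewrite -ler_norml -(@ler_pXn2r _ 2) ?nnegrE// expr1n real_normK ?num_real//.
  apply: le_trans x1; rewrite (bigD1 i)//= !mxE -expr2 lerDl sumr_ge0// => j _.
  by rewrite -expr2 sqr_ge0.
by rewrite lebesgue_tuple_cube ?ltry//; lra.
Qed.

Lemma unit_tball_gt0 n : (0 < mu n (unit_tball n))%E.
Proof.
(* A cube of side 1/(n+1) fits in the ball because n/(n+1) <= 1; taking n+1 instead of n also covers
   dimension 0. *)
have c0 : 0 < n.+1%:R^-1 :> R by rewrite invr_gt0 ltr0n.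
have mC := @measurable_tcube n (0) (n.+1%:R^-1).
apply: (@lt_le_trans _ _ (mu n [set x | forall i, 0 <= tnth x i <= n.+1%:R^-1])).
  by rewrite lebesgue_tuple_cube ?ltW// lte_fin exprn_gt0// subr0.
apply: le_measure; rewrite ?inE//; first exact: measurable_unit_tball.
move=> x /= hx; rewrite /unit_tball/= dotvE.
apply: (@le_trans _ _ (\sum_(i < n) n.+1%:R^-1)).
  apply: ler_sum => i _; rewrite !mxE; have /andP[h1 h2] := hx i.
  rewrite -[leRHS]mulr1 ler_pM// (le_trans h2)// invf_le1 ?ltr0n//.
  by rewrite ler1n.
by rewrite sumr_const card_ord -[leLHS]mulr_natr mulrC ler_pdivrMr ?ltr0n// mul1r ler_nat.
Qed.

Lemma lebesgue_tuple_isometry n (F : n.-tuple TR -> n.-tuple TR) :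
  tiso (fun x => tv (F x)) -> (forall y, exists x, F x = y) ->
  measurable_fun setT F /\
  forall B, measurable B -> mu n (F @^-1` B) = mu n B.
Proof.
move=> Fi Fs; have Fi' := tiso_isometric Fi.
have mF : measurable_fun setT F.
  apply/measurable_fun_tnthP => i.
  rewrite (_ : _ \o _ = fun x => tv (F x) 0 i); first exact: measurable_tiso.
  by apply/funext => x /=; rewrite mxE.
split=> // B mB.
have mopp : measurable (@topp R n @^-1` B).
  by apply: measurable_preimageT => //; exact: (@measurable_topp R _ _ n (fun x => x)).
have b0 := unit_tball_gt0 n; have bf := unit_tball_fin n.
have mb := @measurable_unit_tball n.
have oppK (C : set (n.-tuple TR)) : topp (n:=n) @^-1` (topp (n:=n) @^-1` C) = C.
  by apply/funext => x; rewrite /preimage/=; congr (C _); apply: eq_from_tnth => i;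
     rewrite !tupE opprK.
have cancel_ball (x y : \bar R) :
    (mu n (unit_tball n) * x = y * mu n (unit_tball n) -> x = y)%E.
  move: (mu n _) b0 bf => [r| |]//=; rewrite lte_fin => r0 _.
  rewrite muleC; move: x y => [x| |] [y| |]//=;
    rewrite ?(gt0_mulye, gt0_mulNye, gt0_muley, gt0_muleNy, lte_fin)//.
  by rewrite -!EFinM => -[] /(mulIf (lt0r_neq0 r0)) ->.
(* Surjectivity gives a with F a = F 0 + x, and affinity turns translation by a into translation by
   x. *)
have shiftF x : exists a, forall y, F (tadd y a) = tadd (F y) x.
  have [a aE] := Fs (tadd (F (vt 0)) x).
  exists a => y; apply: (can_inj (@tvK R n)).
  have := isometric_affine Fi' (tv y) 1 (tv a).
  rewrite /= !scale1r -tvD !tvK => ->; rewrite aE !tvD.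
  by apply/rowP => i; rewrite !mxE; lra.
(* After the shift that cancels [F 0], F preserves the norm, hence the ball. *)
have Fball : mu n (F @^-1` unit_tball n) = mu n (unit_tball n).
  have [a aE] := shiftF (topp (F (vt 0))).
  rewrite -(lebesgue_tuple_shift a); last exact: measurable_preimageT.
  congr (mu n _); apply/funext => y; rewrite /preimage/= /unit_tball/= aE tvD tvN.
  by rewrite Fi vtK subr0.
(* The exchange formula for the identity map gives invariance under x |-> - x, which then removes
   the reflection that the formula introduces for F. *)
have opp1 C : measurable C -> mu n C = mu n (topp (n:=n) @^-1` C).
  move=> mC; apply: cancel_ball.
  have mid : measurable_fun [set: n.-tuple TR] id by [].
  have := haar_exchange mid _ mC mb.
  by rewrite !preimage_id; apply=> x; exists x.
rewrite [RHS]opp1//; apply/esym/cancel_ball.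
have := @haar_exchange R n F _ _ mF shiftF mopp mb.
by rewrite Fball oppK.
Qed.

End isometry_invariance.

(** * Hyperplane sections of the cube *)

Section hyperplane_section.
Context {R : realType}.
Local Notation leb := (@lebesgue_measure R).
Local Notation TR := (measurableTypeR R).
Local Notation mu := (@lebesgue_tuple R).

Definition sign_vector n (e : 'rV[R]_n) : Prop := forall i, e 0 i * e 0 i = 1.

Lemma dotv_sign n (e : 'rV[R]_n) : sign_vector e -> dotv e e = n%:R.
Proof.
by move=> se; rewrite dotvE (eq_bigr (fun=> 1)) ?sumr_const ?card_ord.
Qed.

Lemma measurable_cube_preimage d (T : measurableType d) n (g : T -> 'rV[R]_n) :
  (forall i, measurable_fun setT (fun x => g x 0 i : TR)) ->
  measurable (g @^-1` @cube R n).
Proof.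
move=> mg; rewrite (_ : _ @^-1` _ = \bigcap_(i in [set: 'I_n])
    ((fun x => g x 0 i : TR) @^-1` `[0, 1]%classic)).
  apply: fin_bigcap_measurable => // i _; exact: measurable_preimageT.
apply/seteqP; split=> x /= h i.
  by move=> _ /=; rewrite in_itv/=; exact: h.
by have := h i Logic.I; rewrite /= in_itv.
Qed.

Definition height k (e : 'rV[R]_k.+1) (c : R) (y : k.-tuple TR) : R :=
  e 0 0 * (c - \sum_(i < k) e 0 (lift ord0 i) * tnth y i).

Definition graph_point k (e : 'rV[R]_k.+1) (c : R) (y : k.-tuple TR) : 'rV[R]_k.+1 :=
  tv (tuple_cons (height e c y : TR, y)).

Lemma measurable_height k (e : 'rV[R]_k.+1) c :
  measurable_fun setT (height e c : _ -> TR).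
Proof.
apply: measurable_funM => //; apply: measurable_funB => //.
by apply: measurable_sum => i; apply: measurable_funM => //; exact: measurable_tnth.
Qed.

Lemma measurable_graph_point k (e : 'rV[R]_k.+1) c i :
  measurable_fun setT (fun y => graph_point e c y 0 i : TR).
Proof.
apply: (measurableT_comp (measurable_tv i)).
exact: (@measurable_cons _ _ (k.-tuple TR) TR (height e c) k (fun y => y)
  (measurable_height e c)).
Qed.

Lemma height_sub k (e : 'rV[R]_k.+1) c (x : TR) (y : k.-tuple TR) : sign_vector e ->
  x - height e c y = e 0 0 * (dotv (tv (tuple_cons (x, y))) e - c).
Proof.
move=> se; rewrite /height dotvE big_ord_recl !mxE tnth_tuple_cons0.
under [in RHS]eq_bigr do rewrite mxE tnth_tuple_consS mulrC.
have := se 0; rewrite (_ : ord0 = 0)//.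
move: (e 0 0) (\sum_(i < k) _) => a s aa.
by rewrite !mulrBr mulrDr [a * (x * a)]mulrCA aa; lra.
Qed.

(* The slab of thickness 1 around the section in the direction of the first axis
   is measured twice: along that axis, over the graph parametrization, and along
   the unit normal, over the chart f, where its thickness is 1 / sqrt (k + 1). *)
Lemma section_volume_graph k (e q : 'rV[R]_k.+1) (f : k.-tuple TR -> 'rV[R]_k.+1) :
  sign_vector e -> tiso f -> range f = [set x | dotv (x - q) e = 0] ->
  mu k (f @^-1` @cube R k.+1) =
  ((Num.sqrt k.+1%:R)%:E * mu k (graph_point e (dotv q e) @^-1` @cube R k.+1))%E.
Proof.
move=> se fi fH; set c := dotv q e; set d : R := k.+1%:R; set r := Num.sqrt d.
have d0 : 0 < d by rewrite ltr0n.
have r0 : 0 < r by rewrite sqrtr_gt0.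
have rr : r * r = d by rewrite -expr2 sqr_sqrtr ?ltW.
have ee : dotv e e = d by exact: dotv_sign.
have fe z : dotv (f z) e = c.
  have : range f (f z) by exists z.
  by rewrite fH/= dotvBl => /eqP; rewrite subr_eq0 => /eqP.
have mfc : measurable (f @^-1` @cube R k.+1).
  by apply: measurable_cube_preimage => i; exact: measurable_tiso.
have mgc : measurable (graph_point e c @^-1` @cube R k.+1).
  by apply: measurable_cube_preimage => i; exact: measurable_graph_point.
pose D := [set x : k.+1.-tuple TR |
  cube (graph_point e c [tuple of behead x]) /\
  `|tnth x ord0 - height e c [tuple of behead x]| <= 2^-1].
have mD : measurable D.
  apply: measurableI.
    exact: (measurable_preimageT (@measurable_behead _ TR k) mgc).
  rewrite [X in measurable X](_ : _ = (fun x : k.+1.-tuple TR =>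
     `|tnth x ord0 - height e c [tuple of behead x]| : TR) @^-1` `]-oo, 2^-1]%classic).
    apply: measurable_preimageT => //; apply: measurableT_comp => //.
    apply: measurable_funB; first exact: measurable_tnth.
    by apply: measurableT_comp; [exact: measurable_height|exact: measurable_behead].
  by apply/seteqP; split=> x /=; rewrite in_itv.
have bheadK x (y : k.-tuple TR) : [tuple of behead (tuple_cons (x, y))] = y.
  exact: val_inj.
have muD : mu k.+1 D = mu k (graph_point e c @^-1` @cube R k.+1).
  rewrite lebesgue_tupleS_swap// -[RHS]mul1e.
  rewrite -(@integral_cst_restrict _ _ _ _ _ (mu k) leb
    (graph_point e c @^-1` @cube R k.+1)
    (fun y x => `|x - height e c y| <= 2^-1))//.
    apply: eq_integral => y _; congr (leb _).
    by apply/seteqP; split=> x /=; rewrite /D /= bheadK.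
  move=> y _.
  transitivity (leb (`[height e c y - 2^-1, height e c y + 2^-1]%classic : set R)).
    by congr (leb _); apply/seteqP; split=> x /=; rewrite in_itv/= ler_distl.
  rewrite lebesgue_measure_itv/= lte_fin ifT; last by lra.
  by rewrite -EFinB; congr EFin; lra.
(* [e / r] is the unit normal, so (s, z) |-> f z + (s / r) e is an isometry of the whole space: the
   chart completed by the normal coordinate. *)
pose F (x : k.+1.-tuple TR) : k.+1.-tuple TR :=
  vt (f [tuple of behead x] + (tnth x ord0 / r) *: e).
have FE x y : F (tuple_cons (x, y)) = vt (f y + (x / r) *: e).
  by rewrite /F bheadK.
have Fi : tiso (fun x => tv (F x)).
  move=> x y; rewrite (tuple_cons_eta x) (tuple_cons_eta y).
  move: (tnth x ord0) (tnth y ord0) [tuple of behead x] [tuple of behead y].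
  move=> s s' z z'; rewrite !FE !vtK.
  rewrite opprD addrACA -scalerBl -mulrBl.
  have fe0 : dotv (f z - f z') e = 0 by rewrite dotvBl !fe subrr.
  have expand u a : dotv u e = 0 -> dotv (u + a *: e) (u + a *: e) = dotv u u + a * (a * d).
    by move=> ue; rewrite !(dotvDl, dotvDr, dotvZl, dotvZr) ee (dotvC e u) ue; lra.
  rewrite expand// fi.
  rewrite [RHS]dotvE big_ord_recl !mxE.
  rewrite [X in _ = _ + X](_ : _ = dotv (tv z - tv z') (tv z - tv z')); last first.
    by rewrite dotvE; apply: eq_bigr => i _; rewrite !mxE !tnth_tuple_consS.
  by rewrite -rr !tnth_tuple_cons0; field; exact: lt0r_neq0.
have Fs y : exists x, F x = y.
  pose s := (dotv (tv y) e - c) / d.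
  have [z _ zE] : range f (tv y - s *: e).
    rewrite fH /= !dotvBl dotvZl ee -/c /s divfK ?lt0r_neq0//.
    by lra.
  exists (tuple_cons ((s * r : R), z)); rewrite FE zE mulfK ?lt0r_neq0// subrK tvK//.
have [mF FD] := lebesgue_tuple_isometry Fi Fs.
rewrite -muD -(FD D mD).
(* Going s / r along the normal and then back to the hyperplane along the first axis is a
   displacement by s m inside the hyperplane; m is orthogonal to e, and a realizes it in the
   chart. *)
pose m := r^-1 *: e - (e 0 0 * r) *: delta_mx 0 0.
have [a _ aE] : range f (f (vt 0) + m).
  rewrite fH /= dotvBl -/c dotvDl fe addrAC subrr add0r /m dotvBl !dotvZl ee.
  rewrite (_ : dotv _ e = e 0 0).
    by rewrite mulrAC se mul1r -rr mulrA mulVf ?lt0r_neq0// mul1r subrr.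
  by rewrite dotvE big_ord_recl !mxE/= big1 ?addr0 ?mul1r// => i _; rewrite !mxE/= mul0r.
have fm z (s : R) : f (tadd z (vt (s *: tv a))) = f z + s *: m.
  have := isometric_affine (tiso_isometric fi) (tv z) s (tv a).
  rewrite /= !tvK aE addrAC subrr add0r => <-.
  by congr f; apply: (can_inj (@tvK R k)); rewrite tvD !vtK.
rewrite lebesgue_tupleS.
(* At normal height s the slab is a translate, in the chart, of the preimage of the cube if |s| <= 1
   / (2 r), and empty otherwise; hence the factor 1 / r. *)
rewrite (_ : (fun _ => _) = (fun s => mu k [set z | (`[- (r^-1 / 2), r^-1 / 2]%classic : set R) s /\
    cube (f (tadd z (vt (s *: tv a))))])); last first.
  apply/funext => s; congr (mu k _); apply/funext => z; rewrite /preimage /= FE /D/=.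
  set x := f z + _.
  have xE : vt x = tuple_cons (x 0 0, [tuple of behead (vt x)]).
    by rewrite {1}(tuple_cons_eta (vt x)) tnth_mktuple.
  have hx : tnth (vt x) ord0 - height e c [tuple of behead (vt x)] = e 0 0 * (r * s).
    rewrite height_sub// -tuple_cons_eta vtK /x dotvDl fe dotvZl ee; congr (_ * _).
    by rewrite -rr; field; exact: lt0r_neq0.
  have gx : graph_point e c [tuple of behead (vt x)] = f z + s *: m.
    rewrite /graph_point.
    rewrite (_ : height _ _ _ = tnth (vt x) ord0 - e 0 0 * (r * s)); last by rewrite -hx; lra.
    apply/rowP => i; rewrite !mxE; case: (unliftP ord0 i) => [j|] ->.
      rewrite tnth_tuple_consS.
      have <- : tnth (vt x) (lift ord0 j) = tnth [tuple of behead (vt x)] j.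
        by rewrite [in LHS]xE tnth_tuple_consS.
      by rewrite tnth_mktuple /x !mxE/=; lra.
    by rewrite tnth_tuple_cons0 tnth_mktuple /x !mxE/=; lra.
  rewrite hx gx fm.
  have -> : `|e 0 0 * (r * s)| = r * `|s|.
    rewrite !normrM (gtr0_norm r0) (_ : `|e 0 0| = 1) ?mul1r//.
    apply/eqP; rewrite -(@eqrXn2 _ 2)// ?normr_ge0// expr1n real_normK ?num_real//.
    by rewrite expr2 se.
  rewrite propeqE; split => [[cz rs]|[si cz]]; split => //.
    rewrite in_itv/= -ler_norml mulrC ler_pdivlMr//; lra.
  by move: si; rewrite in_itv/= -ler_norml mulrC ler_pdivlMr//; lra.
rewrite (@integral_cst_restrict _ _ _ _ _ leb (mu k) (`[- (r^-1 / 2), r^-1 / 2]%classic : set R)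
  (fun s z => cube (f (tadd z (vt (s *: tv a))))) (mu k (f @^-1` @cube R k.+1)))//.
  have li : leb (`[- (r^-1 / 2), r^-1 / 2]%classic : set R) = (r^-1)%:E.
    have : 0 < r^-1 by rewrite invr_gt0.
    move=> ?; rewrite lebesgue_measure_itv/= lte_fin ifT; last by lra.
    by rewrite -EFinB; congr EFin; lra.
  rewrite [X in (_ * (_ * X))%E](_ : _ = (r^-1)%:E); last exact: li.
  rewrite [in RHS]muleC -muleA -EFinM mulVf ?mule1// lt0r_neq0//.
move=> s _; rewrite -[RHS](lebesgue_tuple_shift (vt (s *: tv a)))//.
Qed.

End hyperplane_section.

(** * Reduction of the section volume to a slab of the cube of one dimension less *)

Section section_volume_slab.
Context {R : realType}.
Local Notation leb := (@lebesgue_measure R).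
Local Notation TR := (measurableTypeR R).
Local Notation mu := (@lebesgue_tuple R).

Definition slab k (e : 'I_k -> R) (s : R) : set (k.-tuple TR) :=
  [set y | (forall i, 0 <= tnth y i <= 1) /\
           `|s - \sum_(i < k) e i * (tnth y i - 2^-1)| <= 2^-1].

(** The first coordinate of the graph point is 1/2 plus or minus the offset s - sum_i e_i (y_i -
    1/2), so it lies in [0, 1] exactly when this offset is at most 1/2 in absolute value. *)
Lemma graph_point_slab k (e q : 'rV[R]_k.+1) : sign_vector e ->
  graph_point e (dotv q e) @^-1` @cube R k.+1 =
  slab (fun i => e 0 (lift ord0 i)) (dotv (q - cube_center k.+1) e).
Proof.
move=> se; apply/funext => y; rewrite /preimage /slab /=.
set s := dotv (q - _) e.
have hE : height e (dotv q e) y =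
    2^-1 + e 0 0 * (s - \sum_(i < k) e 0 (lift ord0 i) * (tnth y i - 2^-1)).
  have cE : dotv (cube_center k.+1) e =
      2^-1 * e 0 0 + \sum_(i < k) e 0 (lift ord0 i) * 2^-1.
    rewrite dotvE big_ord_recl !mxE; congr (_ + _).
    by apply: eq_bigr => i _; rewrite mxE mulrC.
  rewrite /height /s dotvBl cE.
  have -> : \sum_(i < k) e 0 (lift ord0 i) * (tnth y i - 2^-1) =
      \sum_(i < k) e 0 (lift ord0 i) * tnth y i - \sum_(i < k) e 0 (lift ord0 i) * 2^-1.
    by rewrite -sumrB; apply: eq_bigr => i _; rewrite mulrBr.
  have := se 0.
  move: (e 0 0) (dotv q e) (\sum_(i < k) _) (\sum_(i < k) _) => a b c d aa.
  by rewrite !(mulrBr, mulrDr, opprD, opprB) [a * (2^-1 * a)]mulrCA aa; lra.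
have e0 : `|e 0 0| = 1.
  apply/eqP; rewrite -(@eqrXn2 _ 2)// ?normr_ge0// expr1n real_normK ?num_real//.
  by rewrite expr2 se.
have hh : (0 <= height e (dotv q e) y <= 1) =
    (`|s - \sum_(i < k) e 0 (lift ord0 i) * (tnth y i - 2^-1)| <= 2^-1).
  rewrite hE; set z := s - _.
  rewrite (_ : `|z| = `|e 0 0 * z|); last by rewrite normrM e0 mul1r.
  rewrite ler_norml.
  by move: (_ * z) => v; apply/idP/idP => /andP[h1 h2]; apply/andP; split; lra.
rewrite propeqE; split=> [h|[h hs] i].
  split=> [i|]; last by rewrite -hh; have := h ord0; rewrite mxE.
  by have := h (lift ord0 i); rewrite mxE tnth_tuple_consS.
rewrite mxE; case: (unliftP ord0 i) => [j|] ->; first by rewrite tnth_tuple_consS.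
by rewrite tnth_tuple_cons0 hh.
Qed.

Lemma slab_measure0 (e : 'I_0 -> R) s : `|s| <= 2^-1 -> mu 0 (slab e s) = 1%E.
Proof.
move=> hs; rewrite /= diracE mem_set//= /slab/=; split; first by case.
by rewrite big_ord0 subr0.
Qed.

Lemma slab_measure0N (e : 'I_0 -> R) s : ~~ (`|s| <= 2^-1) -> mu 0 (slab e s) = 0%E.
Proof.
move=> hs; rewrite /= diracE memNset//= /slab/= => -[_].
by rewrite big_ord0 subr0; exact/negP.
Qed.

Lemma slab_measureS k (e : 'I_k.+1 -> R) s :
  mu k.+1 (slab e s) = (\int[leb]_(x in `[0%R, 1%R]%classic)
    mu k (slab (fun i => e (lift ord0 i)) (s - e ord0 * ((x : R) - 2^-1))%R))%E.
Proof.
rewrite lebesgue_tupleS [RHS]integral_mkcond; apply: eq_integral => x _.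
rewrite patchE /=; case: ifPn => [|]; rewrite (inE, notin_setE)/= in_itv/= => x01.
  congr (mu k _); apply/seteqP; split=> y; rewrite /slab /= big_ord_recl tnth_tuple_cons0.
    move=> [h1 h2]; split=> [i|].
      by have := h1 (lift ord0 i); rewrite tnth_tuple_consS.
    rewrite -addrA -opprD; under eq_bigr do rewrite -[tnth y _](tnth_tuple_consS x).
    by [].
  move=> [h1 h2]; split=> [i|].
    by case: (unliftP ord0 i) => [j|] ->; rewrite ?tnth_tuple_consS.
  under eq_bigr do rewrite tnth_tuple_consS.
  by rewrite opprD addrA.
rewrite (_ : [set y | _] = set0) ?measure0// -subset0 => y /= [/(_ ord0)].
by rewrite tnth_tuple_cons0.
Qed.

Lemma inf_min (A : set R) a : A a -> (forall b, A b -> a <= b) -> inf A = a.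
Proof.
move=> Aa lbA; apply/eqP; rewrite eq_le; apply/andP; split.
  by apply: ge_inf => //; exists a.
by apply: lb_le_inf; [exists a|move=> b Ab; exact: lbA].
Qed.

(** The minimum is attained at the foot of the perpendicular, c + (w / d) e; the lower bound says
    that x - c minus its projection on e has nonnegative squared norm. *)
Lemma hyperplane_dist k (e q c : 'rV[R]_k.+1) : sign_vector e ->
  inf [set enorm (x - c) | x in [set x | dotv (x - q) e = 0]] =
  `|dotv (q - c) e| / Num.sqrt k.+1%:R.
Proof.
move=> se; have ee := dotv_sign se.
set d : R := k.+1%:R in ee *; set w := dotv (q - c) e.
have d0 : 0 < d by rewrite ltr0n.
have r0 : 0 < Num.sqrt d by rewrite sqrtr_gt0.
have sq : (`|w| / Num.sqrt d) ^+ 2 = w ^+ 2 / d.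
  by rewrite expr_div_n real_normK ?num_real// sqr_sqrtr// ltW.
have pos : 0 <= `|w| / Num.sqrt d by rewrite divr_ge0// ltW.
have rt : `|w| / Num.sqrt d = Num.sqrt (w ^+ 2 / d).
  by rewrite -sq sqrtr_sqr [RHS]ger0_norm.
apply: inf_min.
  exists (c + (w / d) *: e) => /=.
    rewrite addrAC dotvDl dotvZl ee divfK ?lt0r_neq0//.
    by rewrite -(opprB q) dotvNl addNr.
  by rewrite addrAC subrr add0r rt /enorm !(dotvZl, dotvZr) ee; congr Num.sqrt; field;
     rewrite lt0r_neq0.
move=> _ [x /= xH <-]; rewrite rt /enorm ler_wsqrtr//.
have xw : dotv (x - c) e = w.
  have := xH; rewrite /w !dotvBl => xq.
  by move: xq; move: (dotv x e) (dotv q e) (dotv c e) => a b g; lra.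
have := dotv_ge0 (x - c - (w / d) *: e).
rewrite dotvBl !(dotvBr _ ((w / d) *: e)) !(dotvZl, dotvZr) ee (dotvC e) xw.
have -> : w / d * (w / d * d) = w ^+ 2 / d by field; rewrite lt0r_neq0.
have -> : w / d * w = w ^+ 2 / d by field; rewrite lt0r_neq0.
by move: (dotv _ _) (w ^+ 2 / d) => a b; lra.
Qed.

(** Householder reflection. For w = 0 the convention 1 / 0 = 0 makes it the identity, which covers
    the case where the two vectors to exchange coincide. *)
Definition reflection n (w x : 'rV[R]_n) : 'rV[R]_n :=
  x - (2 * dotv x w / dotv w w) *: w.

Lemma reflection_dotv n (w x y : 'rV[R]_n) :
  dotv (reflection w x) (reflection w y) = dotv x y.
Proof.
rewrite /reflection dotvBl !dotvBr !(dotvZl, dotvZr) (dotvC w y).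
have [->|w0] := eqVneq (dotv w w) 0; first by rewrite invr0; lra.
by field.
Qed.

Lemma reflectionB n (w x y : 'rV[R]_n) :
  reflection w x - reflection w y = reflection w (x - y).
Proof. by rewrite /reflection dotvBl; apply/rowP => i; rewrite !mxE; lra. Qed.

Lemma reflectionK n (w : 'rV[R]_n) : involutive (reflection w).
Proof.
move=> x; rewrite {1}/reflection.
have [w0|w0] := eqVneq (dotv w w) 0.
  by rewrite /reflection w0 invr0 !mulr0 !scale0r !subr0.
have -> : dotv (reflection w x) w = - dotv x w.
  by rewrite /reflection dotvBl dotvZl; field.
by rewrite /reflection; apply/rowP => i; rewrite !mxE; lra.
Qed.

Lemma reflection_swap n (u v : 'rV[R]_n) : dotv u u = dotv v v ->
  reflection (u - v) u = v.
Proof.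
move=> uv; rewrite /reflection.
have [w0|w0] := eqVneq (dotv (u - v) (u - v)) 0.
  have /eqP := dotv_eq0 w0; rewrite subr_eq0 => /eqP ->.
  by rewrite subrr scaler0 subr0.
have -> : 2 * dotv u (u - v) = dotv (u - v) (u - v).
  by rewrite !(dotvBl, dotvBr) uv (dotvC v u); lra.
by rewrite divff// scale1r opprB addrC subrK.
Qed.

(** The reflection exchanging the first basis vector with the unit normal carries the coordinate
    hyperplane x_0 = 0 onto the direction of the given one. *)
Lemma isometric_chart_exists k (e q : 'rV[R]_k.+1) : sign_vector e ->
  exists f : k.-tuple TR -> 'rV[R]_k.+1,
    isometric_chart [set x | dotv (x - q) e = 0] f.
Proof.
move=> se; have ee := dotv_sign se; set d : R := k.+1%:R in ee.
have d0 : 0 < d by rewrite ltr0n.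
have r0 : 0 < Num.sqrt d by rewrite sqrtr_gt0.
pose o : 'rV[R]_k.+1 := delta_mx 0 0.
have dotv_o u : dotv u o = u 0 0.
  rewrite dotvE big_ord_recl !mxE/= mulr1 big1 ?addr0// => i _.
  by rewrite !mxE/= mulr0.
pose n := (Num.sqrt d)^-1 *: e.
have nn : dotv o o = dotv n n.
  rewrite dotv_o mxE/= /n dotvZl dotvZr ee.
  rewrite [X in _ * (_ * X)](_ : _ = Num.sqrt d * Num.sqrt d); last first.
    by rewrite -expr2 sqr_sqrtr ?ltW.
  by rewrite /= mulKf ?mulVf// lt0r_neq0.
pose A := reflection (o - n).
have Ao : A o = n by exact: reflection_swap.
have An : A n = o by rewrite -Ao /A reflectionK.
have en : e = Num.sqrt d *: n by rewrite scalerA mulfV ?scale1r// lt0r_neq0.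
pose i0 (y : k.-tuple TR) : 'rV[R]_k.+1 := tv (tuple_cons (0 : TR, y)).
exists (fun y => q + A (i0 y)); split.
  move=> y z; apply/enorm_inj; rewrite opprD addrACA subrr add0r reflectionB.
  rewrite reflection_dotv !dotvE big_ord_recl !mxE subrr mul0r add0r.
  by apply: eq_bigr => i _; rewrite !mxE !tnth_tuple_consS.
apply/seteqP; split=> [_ [y _ <-]|x]/=.
  rewrite addrAC subrr add0r en dotvZr -Ao reflection_dotv dotv_o mxE.
  by rewrite mulr0.
rewrite en dotvZr => /eqP; rewrite mulf_eq0 (gt_eqF r0)/= => /eqP xq.
pose u := A (x - q).
have u0 : u 0 0 = 0 by rewrite -dotv_o /u -An reflection_dotv.
exists [tuple of behead (vt u)] => //.
have -> : i0 [tuple of behead (vt u)] = u.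
  rewrite /i0 (_ : (0 : TR) = tnth (vt u) ord0); last by rewrite tnth_mktuple.
  by rewrite -tuple_cons_eta vtK.
by rewrite /u /A reflectionK addrC subrK.
Qed.

(** [key] shows that every hyperplane and chart yields r W. Existence must be proved as well, since
    otherwise [xget] would return its default value 0. *)
Lemma section_volume_slabE k (t W : R) : 0 <= t ->
  (forall (e : 'I_k -> R) s, (forall i, e i * e i = 1) ->
     `|s| = Num.sqrt k.+1%:R * t -> mu k (slab e s) = W%:E) ->
  section_volume k.+1 t = Num.sqrt k.+1%:R * W.
Proof.
move=> t0 hW; set r := Num.sqrt _.
have r0 : 0 < r by rewrite sqrtr_gt0 ltr0n.
have key (e q : 'rV[R]_k.+1) (f : k.-tuple TR -> 'rV[R]_k.+1) : sign_vector e ->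
    isometric_chart [set x | dotv (x - q) e = 0] f ->
    `|dotv (q - cube_center k.+1) e| / r = t ->
    mu k (f @^-1` ([set x | dotv (x - q) e = 0] `&` @cube R k.+1)) = (r * W)%:E.
  move=> se [fi fH] ht.
  rewrite (_ : f @^-1` _ = f @^-1` @cube R k.+1); last first.
    apply/seteqP; split=> y /=; [by case|move=> cy; split=> //].
    by have : range f (f y) by []; rewrite fH.
  have fi' : tiso f.
    move=> x y; have /enorm_inj -> := fi x y.
    by rewrite (_ : \row_i _ = tv x - tv y)//; apply/rowP => i; rewrite !mxE.
  rewrite (section_volume_graph se fi' fH) graph_point_slab// EFinM -/r.
  congr (_ * _)%E; apply: hW => [i|]; first exact: se.
  by rewrite -ht mulrC divfK ?lt0r_neq0.
(* Witness: the main diagonal from 0 to (1, ..., 1), and the hyperplane through the center shifted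
   by t along the unit normal. *)
have : exists v, is_section_volume k.+1 t v.
  pose e : 'rV[R]_k.+1 := const_mx 1.
  have se : sign_vector e by move=> i; rewrite mxE mulr1.
  pose q := cube_center k.+1 + (t / r) *: e.
  have qc : `|dotv (q - cube_center k.+1) e| / r = t.
    rewrite addrAC subrr add0r dotvZl dotv_sign//.
    rewrite ger0_norm; last by rewrite mulr_ge0// divr_ge0// ltW.
    rewrite -[k.+1%:R](@sqr_sqrtr R) ?ler0n// -/r.
    by field; exact: lt0r_neq0.
  have [f fc] := isometric_chart_exists q se.
  exists (r * W), [set x | dotv (x - q) e = 0].
    split.
      exists 0, (const_mx 1), q; split.
        by split=> [i|]; [left; rewrite mxE|rewrite subr0].
      by rewrite subr0.
    by rewrite hyperplane_dist.
  by exists f => //; rewrite key.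
move=> /(@xgetPex _ 0); rewrite -/(section_volume _ _).
move=> [H [[v [w [q [[vv wE] HE]]]] ht] [f fc vE]].
pose e := w - v.
have se : sign_vector e.
  by move=> i; rewrite /e wE !mxE; case: (vv i) => ->; lra.
apply: EFin_inj; rewrite vE.
rewrite HE -/e in ht fc *.
by rewrite key// -hyperplane_dist.
Qed.

End section_volume_slab.

(** * Integrals over the half-line *)

Ltac derive_auto :=
  eapply is_derive_eq; [typeclasses eauto | rewrite /GRing.scale/=].

Ltac continuous_auto :=
  let x := fresh "x" in
  move=> x; apply: differentiable_continuous; apply/derivable1_diffP;
  eapply ex_derive; typeclasses eauto.

Section half_line.
Context {R : realType}.
Local Notation leb := (@lebesgue_measure R).
Local Notation D := (`]0%R, +oo[%classic : set R).

Lemma is_derive_continuous (F f : R -> R) :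
  (forall x : R, is_derive x 1 F (f x)) -> continuous F.
Proof.
move=> dF x; apply: differentiable_continuous; apply/derivable1_diffP.
exact: (@ex_derive _ _ _ _ _ _ _ (dF x)).
Qed.

Lemma integral_half_line (f : R -> R) : measurable_fun setT f ->
  (\int[leb]_(x in D) (f x)%:E = \int[leb]_(x in `[0%R, +oo[) (f x)%:E)%E.
Proof.
move=> mf; rewrite integral_itv_obnd_cbnd//.
exact/measurable_EFinP/measurable_funTS.
Qed.

Lemma ge0_FTC_half_line (f F : R -> R) (l : R) :
  (forall x, 0 <= x -> 0 <= f x) -> continuous f ->
  (forall x : R, is_derive x 1 F (f x)) -> F x @[x --> +oo] --> l ->
  (\int[leb]_(x in D) (f x)%:E = (l - F 0)%:E)%E.
Proof.
move=> f0 cf dF Fl.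
rewrite integral_half_line; last exact: continuous_measurable_fun.
rewrite EFinB; apply: (ge0_continuous_FTC2y f0 (continuous_subspaceT cf) Fl).
- by move=> x _; have [] := dF x.
- by apply: cvg_at_right_filter; exact: (is_derive_continuous dF).
- by move=> x _; rewrite derive1E; have [] := dF x.
Qed.

Lemma integral_atan (a : R) : 0 < a ->
  (\int[leb]_(x in D) (a ^+ 2 / (a ^+ 2 + x ^+ 2))%:E = (a * (pi / 2))%:E)%E.
Proof.
move=> a0; have den x : 0 < a ^+ 2 + x ^+ 2.
  by rewrite ltr_wpDr ?sqr_ge0// exprn_gt0.
have E x : a ^+ 2 / (a ^+ 2 + x ^+ 2) = a * ((1 + (x / a) ^+ 2)^-1 * a^-1).
  by field; rewrite ?lt0r_neq0// ?den.
pose F x := a * atan (x / a).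
have dF (x : R) : is_derive x 1 F (a ^+ 2 / (a ^+ 2 + x ^+ 2)).
  rewrite E /F; derive_auto.
  by ring.
rewrite (@ge0_FTC_half_line _ F (a * (pi / 2)))//.
- by rewrite /F mul0r atan0 mulr0 subr0.
- by move=> x _; rewrite divr_ge0 ?sqr_ge0// ltW.
- move=> x; apply: cvgM; first exact: cvg_cst.
  apply: cvgV; first by rewrite lt0r_neq0.
  apply: cvgD; first exact: cvg_cst.
  by rewrite expr2; under eq_fun do rewrite expr2; apply: cvgM; exact: cvg_id.
- apply: cvgMr; apply: cvg_comp (@cvgy_atan R).
  apply: gt0_cvgMly; last exact: cvg_id.
  by rewrite invr_gt0.
Qed.

Lemma continuous_cauchy (C : R) : continuous (fun x : R => C / (1 + x ^+ 2)).
Proof.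
have c : continuous (fun x : R => 1 + x ^+ 2) by continuous_auto.
move=> x; apply: cvgM; first exact: cvg_cst.
by apply: cvgV (c x); rewrite lt0r_neq0// ltr_wpDr ?sqr_ge0.
Qed.

Lemma measurable_half_line : measurable (D : set (measurableTypeR R)).
Proof. by []. Qed.

Lemma integrable_cauchy (C : R) :
  leb.-integrable D (EFin \o (fun x => C / (1 + x ^+ 2))).
Proof.
have I1 : leb.-integrable D (EFin \o (fun x : R => 1 / (1 + x ^+ 2))).
  apply/integrableP; split.
    apply/measurable_EFinP; apply: measurable_funTS.
    by apply: continuous_measurable_fun; exact: continuous_cauchy.
  rewrite [X in (X < _)%E](_ : _ = (1 * (pi / 2))%:E :> \bar R) ?ltry//.
  rewrite -integral_atan//; apply: eq_integral => x _ /=.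
  by rewrite expr1n ger0_norm// divr_ge0// addr_ge0 ?sqr_ge0.
have := integrableZl measurable_half_line C I1.
by apply: eq_integrable => // x _ /=; rewrite -EFinM mulrA mulr1.
Qed.

(** C / (1 + x^2) is the common integrable majorant for the powers of sinc and for the Gaussian
    moments. *)
Lemma integrable_le_cauchy (C : R) (f : R -> R) : measurable_fun setT f ->
  (forall x, 0 < x -> `|f x| <= C / (1 + x ^+ 2)) ->
  leb.-integrable D (EFin \o f).
Proof.
move=> mf fC; apply: le_integrable (integrable_cauchy C) => //.
  exact/measurable_EFinP/measurable_funTS.
move=> x; rewrite /= in_itv/= andbT lee_fin => x0.
by rewrite (le_trans (fC _ x0))// ler_norm.
Qed.

(** Adding C / (1 + x^2), whose primitive is C atan x, makes the integrand nonnegative; the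
    nonnegative version applies to the sum and the arctangent part is subtracted. *)
Lemma FTC_half_line (f F : R -> R) (l C : R) :
  (forall x, 0 <= x -> `|f x| <= C / (1 + x ^+ 2)) -> continuous f ->
  (forall x : R, is_derive x (1:R) F (f x)) -> F x @[x --> +oo] --> l ->
  \int[leb]_(x in D) f x = l - F 0.
Proof.
move=> fC cf dF Fl.
pose g (x : R) := C / (1 + x ^+ 2).
have den (x : R) : 1 + x ^+ 2 != 0 by rewrite lt0r_neq0// ltr_wpDr ?sqr_ge0.
have dg (x : R) : is_derive x (1:R) (fun x => C * atan x) (g x).
  by derive_auto; rewrite /g; ring.
have cg : continuous g by exact: continuous_cauchy.
have mf : measurable_fun setT f by exact: continuous_measurable_fun.
have If : leb.-integrable D (EFin \o f).
  by apply: (@integrable_le_cauchy C) => // x x0; apply: fC; exact: ltW.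
have Ig := integrable_cauchy C.
have gl : C * atan x @[x --> +oo] --> C * (pi / 2).
  by apply: cvgMr; exact: cvgy_atan.
have Eg : \int[leb]_(x in D) (f x + g x) = (l + C * (pi / 2)) - (F 0 + C * atan 0).
  have fg0 x : 0 <= x -> 0 <= f x + g x.
    by move=> x0; have := fC _ x0; rewrite ler_norml /g => /andP[h _]; lra.
  have cfg : continuous (fun x => f x + g x).
    by move=> x; apply: cvgD; [exact: cf|exact: cg].
  have dfg (x : R) : is_derive x (1 : R) (F + (fun x => C * atan x)) (f x + g x).
    exact: is_deriveD.
  by rewrite /Rintegral (ge0_FTC_half_line fg0 cfg dfg (cvgD Fl gl)).
have E2 : \int[leb]_(x in D) g x = C * (pi / 2).
  transitivity (\int[leb]_(x in D) (C * (1 / (1 + x ^+ 2)))).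
    by apply: eq_Rintegral => x _; rewrite /g mulrA mulr1.
  rewrite RintegralZl//; last exact: integrable_cauchy.
  rewrite /Rintegral; have := integral_atan ltr01; rewrite expr1n => ->.
  by rewrite /= mul1r.
move: Eg; rewrite RintegralD// E2 atan0 mulr0 addr0 [_ - F 0]addrAC.
by move/addIr.
Qed.

Lemma expR_ge_pow n (x : R) : 0 <= x -> x ^+ n / n`!%:R <= expR x.
Proof.
case: n => [|n] x0; first by rewrite expr0 fact0 divr1 -[leLHS](expR0 R) ler_expR.
by apply: le_trans (expR_ge1Dxn n x0); rewrite lerDr.
Qed.

Lemma mul_expRN_le n (x : R) : 0 < x -> x ^+ n * expR (- x) <= n.+1`!%:R / x.
Proof.
move=> x0; rewrite expRN ler_pdivrMr ?expR_gt0// mulrAC ler_pdivlMr//.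
have := expR_ge_pow n.+1 (ltW x0); rewrite ler_pdivrMr ?ltr0n ?fact_gt0//.
by rewrite exprSr [leRHS]mulrC.
Qed.

Lemma cvgy0_le_inv (g : R -> R) (C : R) :
  (forall x, 0 < x -> `|g x| <= C / x) -> g x @[x --> +oo] --> 0.
Proof.
move=> gC; apply/cvgr0Pnorm_lt => e e0.
near=> x.
have x0 : 0 < x by near: x; exact: nbhs_pinfty_gt.
apply: (le_lt_trans (gC _ x0)); rewrite ltr_pdivrMr// mulrC -ltr_pdivrMr//.
by near: x; apply: nbhs_pinfty_gt; rewrite num_real.
Unshelve. all: by end_near. Qed.

End half_line.

(** * Tonelli and Fubini on product sets *)

Section iterated_integrals.
Context d1 d2 (T1 : measurableType d1) (T2 : measurableType d2) {R : realType}.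
Variables (m1 : {sigma_finite_measure set T1 -> \bar R})
  (m2 : {sigma_finite_measure set T2 -> \bar R}).
Local Open Scope ereal_scope.

Lemma integral_patch_setX (A : set T1) (B : set T2) (f : T1 * T2 -> \bar R) :
  \int[m1]_x \int[m2]_y (f \_ (A `*` B)) (x, y) =
  \int[m1]_(x in A) \int[m2]_(y in B) f (x, y).
Proof.
rewrite [RHS]integral_mkcond; apply: eq_integral => x _.
rewrite patchE; case: ifPn => [|]; rewrite (inE, notin_setE) => Ax.
  rewrite [RHS]integral_mkcond; apply: eq_integral => y _; rewrite !patchE.
  case: ifPn; case: ifPn => //; rewrite !(inE, notin_setE) => h1 h2.
    by case: h2.
  by exfalso; apply: h2.
rewrite integral0_eq// => y _; rewrite patchE ifF//.
by apply/negbTE; rewrite notin_setE => -[].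
Qed.

Lemma integral_patch_setX_swap (A : set T1) (B : set T2) (f : T1 * T2 -> \bar R) :
  \int[m2]_y \int[m1]_x (f \_ (A `*` B)) (x, y) =
  \int[m2]_(y in B) \int[m1]_(x in A) f (x, y).
Proof.
rewrite [RHS]integral_mkcond; apply: eq_integral => x _.
rewrite patchE; case: ifPn => [|]; rewrite (inE, notin_setE) => Ax.
  rewrite [RHS]integral_mkcond; apply: eq_integral => y _; rewrite !patchE.
  case: ifPn; case: ifPn => //; rewrite !(inE, notin_setE) => h1 h2.
    by case: h2.
  by exfalso; apply: h2.
rewrite integral0_eq// => y _; rewrite patchE ifF//.
by apply/negbTE; rewrite notin_setE => -[].
Qed.

Lemma tonelli_setX (A : set T1) (B : set T2) (f : T1 * T2 -> \bar R) :
  measurable A -> measurable B -> measurable_fun setT f ->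
  (forall x y, A x -> B y -> 0 <= f (x, y)) ->
  \int[m1]_(x in A) \int[m2]_(y in B) f (x, y) =
  \int[m2]_(y in B) \int[m1]_(x in A) f (x, y).
Proof.
move=> mA mB mf f0; rewrite -integral_patch_setX -integral_patch_setX_swap.
have mAB : measurable (A `*` B) by exact: measurableX.
apply: (@fubini_tonelli _ _ _ _ _ m1 m2 (f \_ (A `*` B))).
  by apply/(measurable_restrictT f mAB)/measurable_funTS.
move=> [x y]; rewrite patchE; case: ifPn => //; rewrite inE => -[/= Ax By].
exact: f0.
Qed.

(** Since A has finite measure, a majorant depending on y alone is integrable on the product. *)
Lemma fubini_setX (A : set T1) (B : set T2) (f : T1 * T2 -> \bar R) (G : T2 -> \bar R) :
  measurable A -> measurable B -> measurable_fun setT f -> measurable_fun setT G ->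
  m1 A < +oo -> m2.-integrable B G ->
  (forall x y, A x -> B y -> `|f (x, y)| <= G y) ->
  \int[m1]_(x in A) \int[m2]_(y in B) f (x, y) =
  \int[m2]_(y in B) \int[m1]_(x in A) f (x, y).
Proof.
move=> mA mB mf mG Aoo iG fG; rewrite -integral_patch_setX -integral_patch_setX_swap.
have mAB : measurable (A `*` B) by exact: measurableX.
have mfAB : measurable_fun setT (f \_ (A `*` B)).
  by apply/(measurable_restrictT f mAB)/measurable_funTS.
have mGAB : measurable_fun setT ((G \o snd) \_ (A `*` B)).
  apply/(measurable_restrictT _ mAB)/measurable_funTS.
  exact: measurableT_comp.
apply: (@Fubini _ _ _ _ _ m1 m2 (f \_ (A `*` B))).
apply: (@le_integrable _ _ _ _ _ _ _ ((G \o snd) \_ (A `*` B))) => //.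
  move=> [x y] _; rewrite !patchE; case: ifPn => //; rewrite inE => -[/= Ax By].
  by apply: le_trans (fG _ _ Ax By) _; exact: lee_abs.
apply/(@integrable12ltyP _ _ _ _ _ m1 m2) => //.
have -> : \int[m1]_x \int[m2]_y `|((G \o snd) \_ (A `*` B)) (x, y)| =
    \int[m1]_(x in A) \int[m2]_(y in B) `|G y|.
  rewrite -[RHS](integral_patch_setX A B (abse \o G \o snd)).
  apply: eq_integral => x _; apply: eq_integral => y _; rewrite !patchE.
  by case: ifPn => //; rewrite abse0.
have /integrableP[_ Goo] := iG.
rewrite integral_cst//; apply: lte_mul_pinfty => //.
  exact: integral_ge0.
by rewrite ge0_fin_numE ?integral_ge0.
Qed.

End iterated_integrals.

(** * The integral of (1 - cos (a v)) / v^2 over the half-line *)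

Section cosine_integral.
Context {R : realType}.
Local Notation leb := (@lebesgue_measure R).
Local Notation TR := (measurableTypeR R).
Local Notation D := (`]0%R, +oo[%classic : set R).

Lemma integral_mul_expR (v : R) : 0 < v ->
  (\int[leb]_(s in D) (s * expR (- (s * v)))%:E = (v ^- 2)%:E)%E.
Proof.
move=> v0; have vn := lt0r_neq0 v0.
pose F (s : R) := - ((s * v^-1 + v ^- 2) * expR (- (s * v))).
have dF (s : R) : is_derive s (1:R) F (s * expR (- (s * v))).
  by rewrite /F; derive_auto; field.
have cf : continuous (fun s : R => s * expR (- (s * v))) by continuous_auto.
have Fl : F s @[s --> +oo] --> 0.
  apply: (@cvgy0_le_inv _ _ (2 / v ^+ 2 / v + 1 / v ^+ 2 / v)) => s s0.
  have sv : 0 < s * v by rewrite mulr_gt0.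
  have h1 := mul_expRN_le 1 sv; have h0 := mul_expRN_le 0 sv.
  rewrite /F normrN ger0_norm; last first.
    by rewrite mulr_ge0 ?expR_ge0// addr_ge0// ?mulr_ge0 ?invr_ge0 ?exprn_ge0// ltW.
  rewrite (_ : _ * _ = ((s * v) ^+ 1 * expR (- (s * v)) + (s * v) ^+ 0 * expR (- (s * v))) / v ^+ 2); last by field.
  rewrite ler_pdivrMr ?exprn_gt0//.
  apply: (le_trans (lerD h1 h0)); rewrite !factS fact0.
  rewrite le_eqVlt; apply/orP; left; apply/eqP; field.
  by rewrite vn lt0r_neq0.
rewrite (ge0_FTC_half_line _ cf dF Fl)//.
  by congr EFin; rewrite /F !mul0r oppr0 expR0; ring.
by move=> s s0; rewrite mulr_ge0 ?expR_ge0.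
Qed.

Lemma integral_expR_1Bcos (a s : R) : 0 < s ->
  (\int[leb]_(v in D) (s * expR (- (s * v)) * (1 - cos (a * v)))%:E =
   (a ^+ 2 / (a ^+ 2 + s ^+ 2))%:E)%E.
Proof.
move=> s0; have den : 0 < a ^+ 2 + s ^+ 2 by rewrite ltr_wpDl ?sqr_ge0// exprn_gt0.
have dn := lt0r_neq0 den.
pose F (v : R) := expR (- (s * v)) * ((s ^+ 2 * cos (a * v) - s * a * sin (a * v)) / (a ^+ 2 + s ^+ 2) - 1).
have dF (v : R) : is_derive v (1:R) F (s * expR (- (s * v)) * (1 - cos (a * v))).
  by rewrite /F; derive_auto; field.
have cf : continuous (fun v : R => s * expR (- (s * v)) * (1 - cos (a * v))) by continuous_auto.
have Fl : F v @[v --> +oo] --> 0.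
  apply: (@cvgy0_le_inv _ _ (((s ^+ 2 + s * `|a|) / (a ^+ 2 + s ^+ 2) + 1) / s)) => v v0.
  have sv : 0 < s * v by rewrite mulr_gt0.
  have h0 := mul_expRN_le 0 sv.
  rewrite /F normrM ger0_norm ?expR_ge0//.
  move: h0; rewrite expr0 mul1r (_ : 1`!%:R / (s * v) = s^-1 / v); last first.
    by rewrite invfM mul1r.
  move=> h0; set K := _ + 1.
  rewrite (_ : K / s / v = s^-1 / v * K); last by rewrite [RHS]mulrC mulrA.
  apply: ler_pM => //.
  rewrite (le_trans (ler_normD _ _))// normrN normr1 lerD2r normrM normfV (gtr0_norm den).
  rewrite ler_pM2r ?invr_gt0// (le_trans (ler_normD _ _))// normrN (normrM (s ^+ 2)) (normrM (s * a)) (normrM s a).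
  rewrite (ger0_norm (sqr_ge0 s)) (gtr0_norm s0) lerD//.
    by rewrite ler_piMr ?sqr_ge0 ?cos_max.
  by rewrite ler_piMr ?mulr_ge0 ?sin_max// ltW.
rewrite (ge0_FTC_half_line _ cf dF Fl)//.
  by congr EFin; rewrite /F !mulr0 oppr0 expR0 cos0 sin0; field.
move=> v v0; rewrite mulr_ge0 ?subr_ge0 ?cos_le1// mulr_ge0 ?expR_ge0//; exact: ltW.
Qed.

(* Tonelli, after writing 1 / v ^ 2 as the integral of s * exp (- s v) over s > 0. *)
Lemma integral_1Bcos (a : R) :
  (\int[leb]_(v in D) ((1 - cos (a * v)) / v ^+ 2)%:E = (`|a| * (pi / 2))%:E)%E.
Proof.
have [->|a0] := eqVneq a 0.
  rewrite normr0 mul0r; apply: integral0_eq => v _.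
  by rewrite mul0r cos0 subrr mul0r.
transitivity (\int[leb]_(v in D) \int[leb]_(s in D)
    (s * expR (- (s * v)) * (1 - cos (a * v)))%:E)%E.
  apply: eq_integral => v; rewrite inE/= in_itv/= andbT => v0.
  have mexp : measurable_fun D (EFin \o (fun s : R => s * expR (- (s * v)))).
    apply/measurable_EFinP; apply: measurable_funTS; apply: continuous_measurable_fun.
    by continuous_auto.
  under eq_integral do rewrite mulrC EFinM.
  rewrite ge0_integralZl//=.
  - by rewrite integral_mul_expR// -EFinM.
  - by move=> s; rewrite in_itv/= andbT => s0; rewrite lee_fin mulr_ge0 ?expR_ge0// ltW.
have mh : measurable_fun [set: TR * TR] (fun z : TR * TR =>
    ((z.2 : R) * expR (- ((z.2 : R) * (z.1 : R))) * (1 - cos (a * (z.1 : R))))%:E).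
  apply/measurable_EFinP; apply: measurable_funM.
    apply: measurable_funM; first exact: measurable_snd.
    apply: (@measurableT_comp _ _ _ _ _ _ expR) => //.
    by apply: measurableT_comp => //; apply: measurable_funM.
  apply: measurable_funB => //.
  apply: (@measurableT_comp _ _ _ _ _ _ cos) => //.
    by apply: continuous_measurable_fun; exact: continuous_cos.
  by apply: measurable_funM.
rewrite (tonelli_setX leb leb (@measurable_half_line R) (@measurable_half_line R) mh); last first.
  move=> v s /=; rewrite !in_itv/= !andbT => v0 s0.
  rewrite lee_fin mulr_ge0 ?subr_ge0 ?cos_le1// mulr_ge0 ?expR_ge0//; exact: ltW.
transitivity (\int[leb]_(s in D) (a ^+ 2 / (a ^+ 2 + s ^+ 2))%:E)%E.
  apply: eq_integral => s; rewrite inE/= in_itv/= andbT => s0.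
  exact: integral_expR_1Bcos.
rewrite -integral_atan ?normr_gt0//; apply: eq_integral => s _.
by rewrite real_normK ?num_real.
Qed.

End cosine_integral.

(** * Fourier representation of the section volume *)

Section slab_fourier.
Context {R : realType}.
Local Notation leb := (@lebesgue_measure R).
Local Notation TR := (measurableTypeR R).
Local Notation mu := (@lebesgue_tuple R).
Local Notation D := (`]0%R, +oo[%classic : set R).

Lemma FTC_itv (f F : R -> R) (a b : R) : a < b -> continuous f ->
  (forall x : R, is_derive x (1 : R) F (f x)) ->
  (\int[leb]_(x in `[a, b]) (f x)%:E = (F b - F a)%:E)%E.
Proof.
move=> ab cf dF; have cF := is_derive_continuous dF.
rewrite (@continuous_FTC2 _ f F a b ab) ?EFinB//.
- exact: continuous_subspaceT.
- split; [by move=> x _; have [] := dF x| |].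
  + by apply: cvg_at_right_filter; exact: cF.
  + by apply: cvg_at_left_filter; exact: cF.
- by move=> x _; rewrite derive1E; have [] := dF x.
Qed.

Lemma ge0_from_derive (f f' : R -> R) :
  (forall x : R, is_derive x (1 : R) f (f' x)) -> 0 <= f 0 ->
  (forall x, 0 <= x -> 0 <= f' x) -> forall x, 0 <= x -> 0 <= f x.
Proof.
move=> df f0 f'0 x x0.
have cf : {within `[0, x], continuous f}.
  by apply: continuous_subspaceT; exact: is_derive_continuous df.
have [c + fE] := MVT_segment x0 (fun y _ => df y) cf.
rewrite in_itv/= => /andP[c0 _]; rewrite subr0 in fE.
by rewrite -[f x](subrK (f 0)) fE addr_ge0// mulr_ge0// f'0.
Qed.

Lemma norm_sin_le (x : R) : `|sin x| <= `|x|.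
Proof.
wlog x0 : x / 0 <= x => [h|].
  have [/h//|/ltW x0] := leP 0 x.
  by rewrite -(normrN x) -(normrN (sin x)) -sinN; apply: h; rewrite oppr_ge0.
rewrite (ger0_norm x0) ler_norml; apply/andP; split.
  rewrite -subr_ge0 opprK.
  have d1 (y : R) : is_derive y (1 : R) (fun x => sin x + x) (cos y + 1) by derive_auto.
  apply: (ge0_from_derive d1) x0; first by rewrite sin0 addr0 lexx.
  by move=> y _; have := cos_geN1 y; lra.
rewrite -subr_ge0.
have d2 (y : R) : is_derive y (1 : R) (fun x => x - sin x) (1 - cos y) by derive_auto.
apply: (ge0_from_derive d2) x0; first by rewrite sin0 subr0 lexx.
by move=> y _; have := cos_le1 y; lra.
Qed.

(* With x / 0 = 0 this gives sinc 0 = 0; sinc is only integrated over ]0, +oo[. *)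
Definition sinc (x : R) : R := sin x / x.

Lemma norm_sinc_le1 (x : R) : `|sinc x| <= 1.
Proof.
have [->|x0] := eqVneq x 0; first by rewrite /sinc sin0 mul0r normr0.
by rewrite normrM normfV ler_pdivrMr ?normr_gt0// mul1r norm_sin_le.
Qed.

(** Adds the two bounds sinc^2 <= 1 and x^2 sinc^2 = sin^2 <= 1. *)
Lemma sqr_sinc_le (x : R) : x != 0 -> sinc x ^+ 2 <= 2 / (1 + x ^+ 2).
Proof.
move=> x0; have x2 : 0 < x ^+ 2 by rewrite exprn_even_gt0.
rewrite ler_pdivlMr; last by lra.
have h1 : sinc x ^+ 2 <= 1.
  by rewrite -real_normK ?num_real// expr_le1// norm_sinc_le1.
have h2 : sinc x ^+ 2 * x ^+ 2 <= 1.
  rewrite -exprMn /sinc divfK// -real_normK ?num_real// expr_le1//; exact: sin_max.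
by rewrite mulrDr mulr1; lra.
Qed.

Lemma norm_sincX_le (n : nat) (x : R) : (1 < n)%N -> x != 0 ->
  `|sinc x ^+ n| <= 2 / (1 + x ^+ 2).
Proof.
move=> n1 x0; apply: le_trans (sqr_sinc_le x0).
rewrite -[n](subnK n1) exprD normrM [`|sinc x ^+ 2|]ger0_norm ?sqr_ge0//.
by rewrite ler_piMl ?sqr_ge0// normrX exprn_ile1// norm_sinc_le1.
Qed.

Lemma cauchy_scale (l v : R) : 0 < l ->
  2 / (1 + (l * v) ^+ 2) <= 2 * (1 + l ^- 2) / (1 + v ^+ 2).
Proof.
move=> l0.
have d1 : 0 < 1 + (l * v) ^+ 2 by rewrite ltr_wpDr ?sqr_ge0.
have d2 : 0 < 1 + v ^+ 2 by rewrite ltr_wpDr ?sqr_ge0.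
rewrite ler_pdivrMr// mulrAC ler_pdivlMr// -[leRHS]mulrA ler_pM2l//.
rewrite (_ : (1 + l ^- 2) * _ = 1 + v ^+ 2 + (l * v) ^+ 2 + l ^- 2); last first.
  by field; exact: lt0r_neq0.
have := sqr_ge0 (l * v); have : 0 <= l ^- 2 by rewrite invr_ge0 sqr_ge0.
by lra.
Qed.

(** Writing 1/x as x (x^2)^(-1) moves the inverse to a nonnegative base, where it is a real power;
    both sides vanish at 0. *)
Lemma measurable_inv : measurable_fun [set: TR] ((fun x : R => x^-1) : TR -> TR).
Proof.
rewrite (_ : (fun _ => _) = (fun x => x * (x ^+ 2) `^ (-1))).
  apply: measurable_funM => //.
  apply: (measurableT_comp (measurable_powR (-1))).
  exact: measurable_funX.
apply/funext => x; rewrite powR_inv1 ?sqr_ge0//.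
by have [->|x0] := eqVneq x 0; [rewrite invr0 mul0r|field].
Qed.

Lemma measurable_sinc : measurable_fun [set: TR] (sinc : TR -> TR).
Proof.
apply: measurable_funM; last exact: measurable_inv.
by apply: continuous_measurable_fun; exact: continuous_sin.
Qed.

Definition sinc_wave (l : R) (n : nat) (s v : R) : R :=
  sinc (l * v) ^+ n * cos (2 * l * s * v).

Lemma measurable_sinc_wave d (T : measurableType d) (l : R) n (f g : T -> TR) :
  measurable_fun setT f -> measurable_fun setT g ->
  measurable_fun setT (fun x => sinc_wave l n (f x) (g x) : TR).
Proof.
move=> mf mg; apply: measurable_funM.
  apply: measurable_funX; apply: (measurableT_comp measurable_sinc).
  exact: measurable_funM.
apply: measurableT_comp.
  by apply: continuous_measurable_fun; exact: continuous_cos.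
by apply: measurable_funM => //; exact: measurable_funM.
Qed.

Lemma sinc_wave_le (l : R) n s v : 0 < l -> (1 < n)%N -> 0 < v ->
  `|sinc_wave l n s v| <= 2 * (1 + l ^- 2) / (1 + v ^+ 2).
Proof.
move=> l0 n1 v0; apply: le_trans (cauchy_scale v l0).
have lv : l * v != 0 by rewrite mulf_neq0// lt0r_neq0.
apply: le_trans (norm_sincX_le n1 lv).
by rewrite normrM ler_piMr// cos_max.
Qed.

Lemma integrable_sinc_wave (l : R) n s : 0 < l -> (1 < n)%N ->
  leb.-integrable D (EFin \o sinc_wave l n s).
Proof.
move=> l0 n1; apply: (@integrable_le_cauchy _ (2 * (1 + l ^- 2))).
  exact: (@measurable_sinc_wave _ TR l n (fun=> s) id).
by move=> v v0; exact: sinc_wave_le.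
Qed.

(** By scaling, the value is the same for all l > 0. Keeping l free lets the induction on n run at a
    fixed scale and l = 1 / sqrt d be chosen at the end, without a change of variable in the
    integral. *)
Definition sinc_transform (l : R) (n : nat) (s : R) : R :=
  2 * l / pi * \int[leb]_(v in D) sinc_wave l n s v.

Lemma sin2_cos (x y : R) : sin x ^+ 2 * cos (2 * y) * 4 =
  (1 - cos (2 * (y + x))) + (1 - cos (2 * (y - x))) - 2 * (1 - cos (2 * y)).
Proof.
have [c2 c1] : cos (2 * (y + x)) + cos (2 * (y - x)) = 2 * cos (2 * y) * cos (2 * x) /\
    cos (2 * x) = 1 - 2 * sin x ^+ 2.
  split; first by rewrite mulrBr mulrDr cosD cosB; ring.
  have -> : 2 * x = x + x by ring.
  by rewrite cosD; have := cos2Dsin2 x; lra.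
by move: c2; rewrite c1 => c2; lra.
Qed.

(** The right-hand side is the tent function max(0, 1 - |s|). Writing the integrand as a second
    difference of the functions (1 - cos (a v)) / v^2 keeps every piece absolutely integrable. *)
Lemma sinc_transform2 (l s : R) : 0 < l ->
  sinc_transform l 2 s = (`|s + 1| + `|s - 1| - 2 * `|s|) / 2.
Proof.
move=> l0; have ln := lt0r_neq0 l0.
pose h (a v : R) := (1 - cos (a * v)) / v ^+ 2.
have mh a : measurable_fun [set: TR] (h a : TR -> TR).
  apply: measurable_funM.
    apply: measurable_funB => //; apply: measurableT_comp.
      by apply: continuous_measurable_fun; exact: continuous_cos.
    exact: measurable_funM.
  by apply: (measurableT_comp measurable_inv); exact: measurable_funX.
have Ih a : leb.-integrable D (EFin \o h a).
  apply/integrableP; split; first by apply/measurable_EFinP; exact: (measurable_funTS (mh a)).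
  rewrite [X in (X < _)%E](_ : _ = (`|a| * (pi / 2))%:E) ?ltry//.
  rewrite -integral_1Bcos; apply: eq_integral => v _ /=.
  by rewrite ger0_norm// divr_ge0 ?sqr_ge0// subr_ge0 cos_le1.
have Eh a : \int[leb]_(v in D) h a v = `|a| * (pi / 2).
  by rewrite /Rintegral integral_1Bcos.
have sumI a b : leb.-integrable D (EFin \o (fun v => h a v + h b v)).
  by have := integrableD (@measurable_half_line R) (Ih a) (Ih b).
rewrite /sinc_transform.
have -> : \int[leb]_(v in D) sinc_wave l 2 s v =
    \int[leb]_(v in D) ((4 * l ^+ 2)^-1 *
     (h (2 * (l * s + l)) v + h (2 * (l * s - l)) v - 2 * h (2 * (l * s)) v)).
  apply: eq_Rintegral => v; rewrite inE/= in_itv/= andbT => v0.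
  have vn := lt0r_neq0 v0.
  have := sin2_cos (l * v) (l * s * v).
  rewrite /sinc_wave /sinc /h (_ : 2 * l * s * v = 2 * (l * s * v)); last by ring.
  rewrite -!mulrDl -mulrBl !mulrA => E.
  apply: (@mulIf _ 4); first by rewrite pnatr_eq0.
  rewrite (_ : (sin (l * v) / (l * v)) ^+ 2 * cos (2 * l * s * v) * 4 =
    (sin (l * v) ^+ 2 * cos (2 * l * s * v) * 4) / (l * v) ^+ 2); last by field; rewrite vn.
  rewrite E; field; by rewrite vn.
have Ih2 a : leb.-integrable D (EFin \o (fun v => 2 * h a v)).
  have := integrableZl (@measurable_half_line R) 2 (Ih a).
  by apply: eq_integrable => // x _ /=; rewrite EFinM.
have Iall a b c : leb.-integrable D (EFin \o (fun v => h a v + h b v - 2 * h c v)).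
  by have := integrableB (@measurable_half_line R) (sumI a b) (Ih2 c).
rewrite RintegralZl// RintegralB// RintegralD// RintegralZl// !Eh.
have nl x : `|2 * (l * x)| = 2 * l * `|x|.
  by rewrite !normrM (gtr0_norm l0) (@ger0_norm _ 2)// mulrA.
have -> : l * s + l = l * (s + 1) by ring.
have -> : l * s - l = l * (s - 1) by ring.
rewrite !nl.
have := lt0r_neq0 (pi_gt0 R); move: pi => p pn.
by field; rewrite ln pn.
Qed.


(** Averaging the cosine over a window of length 1 in s multiplies it by sinc (l v), which raises
    the power by one. The exchange of integrals rests on 1 < n, which provides the majorant. *)
Lemma sinc_transformS (l : R) n s e : 0 < l -> (1 < n)%N -> e * e = 1 ->
  (\int[leb]_(x in `[0%R, 1%R]%classic)
    (sinc_transform l n (s - e * ((x : R) - 2^-1)))%:E =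
   (sinc_transform l n.+1 s)%:E)%E.
Proof.
move=> l0 n1 ee.
have e1 : e = 1 \/ e = -1.
  have /eqP : (e - 1) * (e + 1) = 0 by rewrite mulrDr mulr1 mulrBl mul1r ee; ring.
  by rewrite mulf_eq0 subr_eq0 addr_eq0 => /orP[]/eqP ->; [left|right].
have m01 : measurable (`[0%R, 1%R]%classic : set TR) by [].
have mD := @measurable_half_line R.
pose k := 2 * l / pi.
have k0 : 0 <= k by rewrite divr_ge0 ?pi_ge0// mulr_ge0// ltW.
pose C := k * (2 * (1 + l ^- 2)).
pose c (x : R) : R := s - e * (x - 2^-1).
have mc : measurable_fun [set: TR] (c : TR -> TR).
  apply: measurable_funB => //; apply: measurable_funM => //.
  exact: measurable_funB.
have mw : measurable_fun [set: TR * TR]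
    (fun z : TR * TR => (k * sinc_wave l n (c z.1) z.2)%:E).
  apply/measurable_EFinP; apply: measurable_funM => //.
  apply: measurable_sinc_wave => //.
  exact: (measurableT_comp mc).
have mG : measurable_fun [set: TR] (fun v : TR => (C / (1 + (v : R) ^+ 2))%:E).
  apply/measurable_EFinP; apply: continuous_measurable_fun.
  exact: continuous_cauchy.
have fin01 : (leb (`[0%R, 1%R]%classic : set R) < +oo)%E.
  by rewrite lebesgue_measure_itv/= lte_fin ltr01 -EFinB ltry.
have Jint m x : (1 < m)%N -> (\int[leb]_(v in D) (k * sinc_wave l m x v)%:E =
    (sinc_transform l m x)%:E)%E.
  move=> m1; have Iw := integrable_sinc_wave x l0 m1.
  under eq_integral do rewrite EFinM.
  rewrite (integralZl mD Iw).
  rewrite /sinc_transform -/k [RHS]EFinM /Rintegral fineK//.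
  exact: integrable_fin_num.
have inner v : 0 < v -> (\int[leb]_(x in `[0%R, 1%R]%classic)
    (k * sinc_wave l n (c (x : R)) v)%:E = (k * sinc_wave l n.+1 s v)%:E)%E.
  move=> v0; have lv : l * v != 0 by rewrite mulf_neq0// lt0r_neq0.
  pose F (x : R) := k * sinc (l * v) ^+ n *
    (- e * sin (2 * l * (s - e * (x - 2^-1)) * v) / (2 * (l * v))).
  have dF (x : R) : is_derive x (1 : R) F (k * sinc_wave l n (c x) v).
    rewrite /F /sinc_wave /c; derive_auto.
    move: (sinc _ ^+ n) (cos _) => a b; move: lv; rewrite mulf_eq0 negb_or => /andP[l1 v1].
    by case: e1 => ->; field; rewrite l1 v1.
  have cf : continuous (fun x => k * sinc_wave l n (c x) v).
    by rewrite /sinc_wave /c; continuous_auto.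
  rewrite (FTC_itv ltr01 cf dF); congr EFin.
  rewrite /F /sinc_wave exprSr -mulrBr -[in RHS]mulrA [RHS]mulrA; congr (_ * _).
  have -> : 2 * l * (s - e * (1 - 2^-1)) * v = 2 * l * s * v - e * (l * v) by field.
  have -> : 2 * l * (s - e * (0 - 2^-1)) * v = 2 * l * s * v + e * (l * v) by field.
  rewrite /sinc; move: (2 * l * s * v) (l * v) lv => y z z0.
  by case: e1 => ->; rewrite ?mul1r ?mulN1r ?opprK sinB sinD; field.
transitivity (\int[leb]_(x in `[0%R, 1%R]%classic)
    \int[leb]_(v in D) (k * sinc_wave l n (c (x : R)) v)%:E)%E.
  by apply: eq_integral => x _; rewrite Jint.
have iG : leb.-integrable D (fun v : TR => (C / (1 + (v : R) ^+ 2))%:E).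
  exact: integrable_cauchy.
rewrite (fubini_setX m01 mD mw mG fin01 iG).
  rewrite -Jint; last exact: leqW.
  by apply: eq_integral => v; rewrite inE/= in_itv/= andbT => v0; exact: inner.
move=> x v _; rewrite /= in_itv/= andbT => v0; rewrite lee_fin normrM (ger0_norm k0).
by rewrite /C -mulrA ler_wpM2l// sinc_wave_le.
Qed.

Lemma slab_measure1 (e : 'I_1 -> R) s : (forall i, e i * e i = 1) ->
  mu 1 (slab e s) = ((`|s + 1| + `|s - 1| - 2 * `|s|) / 2)%:E.
Proof.
move=> ee; have e1 : e ord0 = 1 \/ e ord0 = -1.
  have /eqP : (e ord0 - 1) * (e ord0 + 1) = 0.
    by rewrite mulrDr mulr1 mulrBl mul1r ee; ring.
  by rewrite mulf_eq0 subr_eq0 addr_eq0 => /orP[]/eqP ->; [left|right].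
(* The sign is absorbed in u: the slab becomes the intersection of [0, 1] and [u, u + 1], and the
   tent is even. *)
pose u := e ord0 * s.
have -> : `|s + 1| + `|s - 1| - 2 * `|s| = `|u + 1| + `|u - 1| - 2 * `|u|.
  rewrite /u; case: e1 => ->; rewrite ?mul1r ?mulN1r// normrN.
  by rewrite -(normrN (- s + 1)) -(normrN (- s - 1)) !opprD !opprK; lra.
pose S : set R := `[u, u + 1]%classic.
have uS (x : R) : (`|s - e ord0 * (x - 2^-1)| <= 2^-1) = (u <= x <= u + 1).
  rewrite /u ler_norml; case: e1 => ->; rewrite ?mul1r ?mulN1r;
  by apply/idP/idP => /andP[h1 h2]; apply/andP; split; lra.
rewrite slab_measureS.
transitivity (\int[leb]_(x in `[0%R, 1%R]%classic) (\1_S x)%:E)%E.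
  apply: eq_integral => x _; rewrite indicE.
  have -> : (x \in S) = (u <= x <= u + 1).
    by apply/idP/idP; rewrite inE /S/= in_itv.
  rewrite -uS; have [xu|xu] := boolP (`|_| <= _); first by rewrite slab_measure0.
  by rewrite slab_measure0N.
have m01 : measurable (`[0%R, 1%R]%classic : set TR) by [].
have mS : measurable (S : set TR) by exact: measurable_itv.
rewrite (integral_indic _ m01)//.
transitivity (leb (`[Num.max 0 u, Num.min 1 (u + 1)]%classic : set R)).
  congr (leb _); apply/seteqP; split=> x /=; rewrite /S/= !in_itv/= ge_max le_min.
    by move=> [/andP[-> ->] /andP[-> ->]].
  by move=> /andP[/andP[-> ->] /andP[-> ->]].
rewrite lebesgue_measure_itv/= lte_fin.
have [h1|h1] := leP 0 u; have [h2|h2] := leP 1 (u + 1); rewrite -?EFinB.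
- have -> : `|u + 1| = u + 1 by (rewrite ger0_norm//; lra).
  rewrite (ger0_norm h1).
  case: ifPn => [h3|]; last rewrite -leNgt => h3.
    have -> : `|u - 1| = 1 - u by (rewrite ltr0_norm ?opprB//; lra).
    by congr EFin; lra.
  have -> : `|u - 1| = u - 1 by (rewrite ger0_norm//; lra).
  by congr EFin; lra.
- by exfalso; lra.
- by exfalso; lra.
- have -> : `|u - 1| = 1 - u by (rewrite ltr0_norm ?opprB//; lra).
  rewrite (ltr0_norm h1).
  case: ifPn => [h3|]; last rewrite -leNgt => h3.
    have -> : `|u + 1| = u + 1 by (rewrite gtr0_norm//; lra).
    by congr EFin; lra.
  have -> : `|u + 1| = - (u + 1) by (rewrite ler0_norm//; lra).
  by congr EFin; lra.
Qed.

Lemma slab_sinc_transform (l : R) k (e : 'I_k.+1 -> R) s : 0 < l ->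
  (forall i, e i * e i = 1) -> mu k.+1 (slab e s) = (sinc_transform l k.+2 s)%:E.
Proof.
move=> l0; elim: k e s => [|k IH] e s ee.
  by rewrite slab_measure1// sinc_transform2.
rewrite slab_measureS -(sinc_transformS _ l0 _ (ee ord0))//.
by apply: eq_integral => x _; rewrite IH.
Qed.

Lemma section_volume_sinc (t : R) (k : nat) : 0 <= t ->
  section_volume k.+2 t = 2 / pi * \int[leb]_(v in D)
    ((sinc (v / Num.sqrt k.+2%:R)) ^+ k.+2 * cos (2 * t * v)).
Proof.
move=> t0; set r := Num.sqrt _.
have r0 : 0 < r by rewrite sqrtr_gt0 ltr0n.
have rn := lt0r_neq0 r0.
have l0 : 0 < r^-1 by rewrite invr_gt0.
rewrite (@section_volume_slabE _ _ _ (sinc_transform r^-1 k.+2 (r * t)))//; last first.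
  move=> e s ee st; rewrite (slab_sinc_transform _ l0)//; congr EFin.
  rewrite /sinc_transform; congr (_ * _); apply: eq_Rintegral => v _.
  rewrite /sinc_wave; congr (_ * _); rewrite -/r in st.
  have -> : r * t = `|s| by [].
  case: (leP 0 s) => [/ger0_norm -> //|/ltr0_norm ->].
  by rewrite mulrN mulNr cosN.
rewrite -/r /sinc_transform.
have -> : \int[leb]_(v in D) sinc_wave r^-1 k.+2 (r * t) v =
    \int[leb]_(v in D) (sinc (v / r) ^+ k.+2 * cos (2 * t * v)).
  apply: eq_Rintegral => v _; rewrite /sinc_wave [v / r]mulrC; congr (_ * cos _).
  by field.
by rewrite mulrA; congr (_ * _); move: pi (lt0r_neq0 (pi_gt0 R)) => p pn; field; rewrite rn pn.
Qed.

End slab_fourier.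

(** * Gaussian moments *)

Section gaussian.
Context {R : realType}.
Local Notation leb := (@lebesgue_measure R).
Local Notation TR := (measurableTypeR R).
Local Notation D := (`]0%R, +oo[%classic : set R).

Definition gauss6 (v : R) : R := expR (- (v ^+ 2 / 6)).

Definition gmoment (k : nat) (f : R -> R) : R :=
  \int[leb]_(v in D) (v ^+ k * gauss6 v * f v).

(** Crude bound for v^j e^(-v^2/6), meant for integrability and limits at infinity: 1 covers v <= 1,
    and j! 6^j comes from one term of the exponential series. *)
Definition gbound (j : nat) : R := 1 + j`!%:R * 6 ^+ j.

Lemma gauss6_ge0 v : 0 <= gauss6 v. Proof. exact: expR_ge0. Qed.

Lemma pow_gauss6_le j v : 0 <= v -> v ^+ j * gauss6 v <= gbound j.
Proof.
move=> v0; have [v1|v1] := leP v 1.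
  have : v ^+ j * gauss6 v <= 1.
    rewrite mulr_ile1 ?exprn_ge0 ?expR_ge0 ?exprn_ile1//.
    by rewrite -expR0 ler_expR oppr_le0 divr_ge0 ?sqr_ge0.
  move/le_trans; apply; rewrite lerDl mulr_ge0 ?exprn_ge0//.
have := expR_ge_pow j (divr_ge0 (sqr_ge0 v) (ler0n R 6)).
rewrite ler_pdivrMr ?ltr0n ?fact_gt0// expr_div_n ler_pdivrMr ?exprn_gt0// => h.
have : v ^+ j <= (v ^+ 2) ^+ j.
  by rewrite -exprM; apply: ler_weXn2l; [exact: ltW|exact: leq_pmull].
move/le_trans => /(_ _ h) {}h.
rewrite /gauss6 expRN ler_pdivrMr ?expR_gt0//.
apply: (le_trans h); rewrite /gbound mulrDl mul1r -mulrA [leRHS]addrC.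
by rewrite [leRHS](_ : _ = expR (v ^+ 2 / 6) * j`!%:R * 6 ^+ j + expR (v ^+ 2 / 6));
  [rewrite -mulrA lerDl expR_ge0|ring].
Qed.

Lemma pow_gauss6_cauchy k (f : R -> R) (M v : R) : 0 <= v -> `|f v| <= M ->
  `|v ^+ k * gauss6 v * f v| <= (gbound k + gbound k.+2) * M / (1 + v ^+ 2).
Proof.
move=> v0 fM; have d : 0 < 1 + v ^+ 2 by rewrite ltr_wpDr ?sqr_ge0.
rewrite ler_pdivlMr// normrM mulrAC ler_pM//.
  by rewrite mulr_ge0// ltW.
rewrite ger0_norm ?mulr_ge0 ?exprn_ge0 ?expR_ge0// mulrDr mulr1 lerD ?pow_gauss6_le//.
by rewrite (_ : _ * _ * _ = v ^+ k.+2 * gauss6 v) ?pow_gauss6_le// !exprS; ring.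
Qed.

Lemma continuous_pow_gauss6 k (f : R -> R) : continuous f ->
  continuous (fun v : R => v ^+ k * gauss6 v * f v).
Proof.
have ce : continuous (fun v : R => v ^+ k * gauss6 v).
  have cg : continuous gauss6 by rewrite /gauss6; continuous_auto.
  by move=> v; apply: cvgM; [exact: exprn_continuous|exact: cg].
by move=> cf v; apply: cvgM; [exact: ce|exact: cf].
Qed.

Lemma integrable_gmoment k (f : R -> R) (M : R) : continuous f ->
  (forall v, 0 <= v -> `|f v| <= M) ->
  leb.-integrable D (EFin \o (fun v => v ^+ k * gauss6 v * f v)).
Proof.
move=> cf fM; apply: (@integrable_le_cauchy _ ((gbound k + gbound k.+2) * M)).
  by apply: continuous_measurable_fun; exact: continuous_pow_gauss6.
by move=> v v0; apply: pow_gauss6_cauchy; [|apply: fM]; exact: ltW.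
Qed.

Lemma cvgy_pow_gauss6 k (f : R -> R) (M : R) :
  (forall v, 0 <= v -> `|f v| <= M) ->
  (v : R) ^+ k * gauss6 v * f v @[v --> +oo] --> 0.
Proof.
move=> fM; apply: (@cvgy0_le_inv _ _ (gbound k.+1 * M)) => v v0.
have v0' := ltW v0.
rewrite ler_pdivlMr// normrM mulrAC; apply: ler_pM => //.
- by rewrite mulr_ge0.
- rewrite ger0_norm ?mulr_ge0 ?exprn_ge0 ?expR_ge0//.
  rewrite (_ : _ * _ * _ = v ^+ k.+1 * gauss6 v) ?pow_gauss6_le//.
  by rewrite exprS; ring.
- exact: fM.
Qed.

Lemma is_derive_gauss6 (v : R) : is_derive v (1 : R) gauss6 (- 3^-1 * v * gauss6 v).
Proof. by rewrite /gauss6; derive_auto; field. Qed.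

(** Integration of the derivative of [gauss6 * f]. The boundary term f 0 survives only at this
    order; for higher moments the factor v^(k+1) kills it. *)
Lemma gmoment_parts0 (f g : R -> R) (M N : R) :
  (forall v : R, is_derive v (1 : R) f (g v)) -> continuous g ->
  (forall v, 0 <= v -> `|f v| <= M) -> (forall v, 0 <= v -> `|g v| <= N) ->
  gmoment 1 f = 3 * (f 0 + gmoment 0 g).
Proof.
move=> df cg fM gN; have cf := is_derive_continuous df.
pose F v := v ^+ 0 * gauss6 v * f v.
pose h v := v ^+ 0 * gauss6 v * g v - 3^-1 * (v ^+ 1 * gauss6 v * f v).
have dF (v : R) : is_derive v (1 : R) F (h v).
  rewrite (_ : F = gauss6 * f); last by apply/funext => w; rewrite /F expr0 mul1r.
  apply: is_derive_eq (is_deriveM (is_derive_gauss6 v) (df v)) _.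
  by rewrite /GRing.scale/= /h expr0 expr1; field.
have ch : continuous h.
  move=> v; apply: cvgB; first exact: continuous_pow_gauss6.
  by apply: cvgM; [exact: cvg_cst|exact: continuous_pow_gauss6].
have hC v : 0 <= v -> `|h v| <= ((gbound 0 + gbound 2) * N +
    3^-1 * ((gbound 1 + gbound 3) * M)) / (1 + v ^+ 2).
  move=> v0; rewrite /h (le_trans (ler_normB _ _))// mulrDl lerD//.
    by apply: pow_gauss6_cauchy => //; exact: gN.
  by rewrite normrM ger0_norm// -[leRHS]mulrA ler_wpM2l//; apply: pow_gauss6_cauchy => //; exact: fM.
have := FTC_half_line hC ch dF (cvgy_pow_gauss6 0 fM).
have I1 := integrable_gmoment 1 cf fM.
have I0 := integrable_gmoment 0 cg gN.
rewrite RintegralB//; last first.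
  have := integrableZl (@measurable_half_line R) 3^-1 I1.
  by apply: eq_integrable => // x _ /=; rewrite EFinM.
rewrite RintegralZl// -/(gmoment 0 g) -/(gmoment 1 f).
rewrite /F expr0 mul1r /gauss6 expr0n mul0r oppr0 expR0 mul1r.
by move: (gmoment 0 g) (gmoment 1 f) => a b; lra.
Qed.

Lemma gmoment_parts k (f g : R -> R) (M N : R) :
  (forall v : R, is_derive v (1 : R) f (g v)) -> continuous g ->
  (forall v, 0 <= v -> `|f v| <= M) -> (forall v, 0 <= v -> `|g v| <= N) ->
  gmoment k.+2 f = 3 * (k.+1%:R * gmoment k f + gmoment k.+1 g).
Proof.
move=> df cg fM gN; have cf := is_derive_continuous df.
pose F v := v ^+ k.+1 * gauss6 v * f v.
pose h v := k.+1%:R * (v ^+ k * gauss6 v * f v) + v ^+ k.+1 * gauss6 v * g v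
   - 3^-1 * (v ^+ k.+2 * gauss6 v * f v).
have dF (v : R) : is_derive v (1 : R) F (h v).
  have dX : is_derive v (1 : R) (fun v : R => v ^+ k.+1) (k.+1%:R * v ^+ k).
    rewrite (_ : (fun _ => _) = (id : R -> R) ^+ k.+1); last by rewrite exprfctE.
    apply: is_derive_eq (@is_deriveX R R id k.+1 v 1 1 (is_derive_id v 1)) _.
    by rewrite /GRing.scale/= mulr1.
  apply: is_derive_eq (is_deriveM (is_deriveM dX (is_derive_gauss6 v)) (df v)) _.
  by rewrite /GRing.scale/= mulrfctE/= /h !exprS; field.
have cZ (a : R) j : continuous (fun v : R => a * (v ^+ j * gauss6 v * f v)).
  by move=> v; apply: cvgM; [exact: cvg_cst|exact: continuous_pow_gauss6].
have ch : continuous h.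
  move=> v; apply: cvgB; last exact: cZ.
  by apply: cvgD; [exact: cZ|exact: continuous_pow_gauss6].
have hC v : 0 <= v -> `|h v| <= (k.+1%:R * ((gbound k + gbound k.+2) * M) +
    (gbound k.+1 + gbound k.+3) * N +
    3^-1 * ((gbound k.+2 + gbound k.+4) * M)) / (1 + v ^+ 2).
  move=> v0; rewrite /h (le_trans (ler_normB _ _))// mulrDl lerD//.
    rewrite (le_trans (ler_normD _ _))// mulrDl lerD//.
      rewrite normrM ger0_norm// -[leRHS]mulrA ler_wpM2l//.
      by apply: pow_gauss6_cauchy => //; exact: fM.
    by apply: pow_gauss6_cauchy => //; exact: gN.
  by rewrite normrM ger0_norm// -[leRHS]mulrA ler_wpM2l//; apply: pow_gauss6_cauchy => //; exact: fM.
have := FTC_half_line hC ch dF (cvgy_pow_gauss6 k.+1 fM).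
have I0 := integrable_gmoment k cf fM.
have I1 := integrable_gmoment k.+1 cg gN.
have I2 := integrable_gmoment k.+2 cf fM.
have IZ (a : R) j : leb.-integrable D (EFin \o (fun v => v ^+ j * gauss6 v * f v)) ->
    leb.-integrable D (EFin \o (fun v => a * (v ^+ j * gauss6 v * f v))).
  move=> Ij; have := integrableZl (@measurable_half_line R) a Ij.
  by apply: eq_integrable => // x _ /=; rewrite EFinM.
have I0Z := IZ k.+1%:R _ I0.
have I2Z := IZ 3^-1 _ I2.
have IS : leb.-integrable D (EFin \o (fun v => k.+1%:R * (v ^+ k * gauss6 v * f v) +
    v ^+ k.+1 * gauss6 v * g v)).
  by have := integrableD (@measurable_half_line R) I0Z I1.
rewrite RintegralB// RintegralD// !RintegralZl//.
rewrite -/(gmoment k f) -/(gmoment k.+1 g) -/(gmoment k.+2 f) /F exprS !mul0r.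
by move: (gmoment k f) (gmoment k.+1 g) (gmoment k.+2 f) => a b c; lra.
Qed.

Lemma gmomentZ k (a M : R) (f : R -> R) : continuous f ->
  (forall v, 0 <= v -> `|f v| <= M) ->
  gmoment k (fun v => a * f v) = a * gmoment k f.
Proof.
move=> cf fM; rewrite /gmoment -RintegralZl//; last exact: integrable_gmoment fM.
by apply: eq_Rintegral => v _; rewrite mulrCA.
Qed.

Definition cosw (t v : R) : R := cos (2 * t * v).
Definition sinw (t v : R) : R := sin (2 * t * v).

Lemma is_derive_cosw t (v : R) : is_derive v (1 : R) (cosw t) (- (2 * t) * sinw t v).
Proof. by rewrite /cosw /sinw; derive_auto; ring. Qed.

Lemma is_derive_sinw t (v : R) : is_derive v (1 : R) (sinw t) (2 * t * cosw t v).
Proof. by rewrite /cosw /sinw; derive_auto; ring. Qed.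

Lemma continuous_cosw t : continuous (cosw t).
Proof. exact: is_derive_continuous (is_derive_cosw t). Qed.

Lemma continuous_sinw t : continuous (sinw t).
Proof. exact: is_derive_continuous (is_derive_sinw t). Qed.

Lemma norm_cosw t v : 0 <= v -> `|cosw t v| <= 1. Proof. by rewrite cos_max. Qed.
Lemma norm_sinw t v : 0 <= v -> `|sinw t v| <= 1. Proof. by rewrite sin_max. Qed.

Lemma norm_dcosw t v : 0 <= v -> `|- (2 * t) * sinw t v| <= `|2 * t|.
Proof. by move=> v0; rewrite normrM normrN ler_piMr// norm_sinw. Qed.

Lemma norm_dsinw t v : 0 <= v -> `|2 * t * cosw t v| <= `|2 * t|.
Proof. by move=> v0; rewrite normrM ler_piMr// norm_cosw. Qed.

Lemma gmoment_cos k t :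
  gmoment k.+2 (cosw t) = 3 * (k.+1%:R * gmoment k (cosw t) - 2 * t * gmoment k.+1 (sinw t)).
Proof.
have cg : continuous (fun v => - (2 * t) * sinw t v).
  by move=> v; apply: cvgM; [exact: cvg_cst|exact: continuous_sinw].
rewrite (gmoment_parts k (is_derive_cosw t) cg (@norm_cosw t) (@norm_dcosw t)).
by rewrite (gmomentZ _ _ (@continuous_sinw t) (@norm_sinw t)) mulNr.
Qed.

Lemma gmoment_sin k t :
  gmoment k.+2 (sinw t) = 3 * (k.+1%:R * gmoment k (sinw t) + 2 * t * gmoment k.+1 (cosw t)).
Proof.
have cg : continuous (fun v => 2 * t * cosw t v).
  by move=> v; apply: cvgM; [exact: cvg_cst|exact: continuous_cosw].
rewrite (gmoment_parts k (is_derive_sinw t) cg (@norm_sinw t) (@norm_dsinw t)).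
by rewrite (gmomentZ _ _ (@continuous_cosw t) (@norm_cosw t)).
Qed.

Lemma gmoment1_sin t : gmoment 1 (sinw t) = 3 * (2 * t * gmoment 0 (cosw t)).
Proof.
have cg : continuous (fun v => 2 * t * cosw t v).
  by move=> v; apply: cvgM; [exact: cvg_cst|exact: continuous_cosw].
rewrite (gmoment_parts0 (is_derive_sinw t) cg (@norm_sinw t) (@norm_dsinw t)).
by rewrite (gmomentZ _ _ (@continuous_cosw t) (@norm_cosw t)) {1}/sinw mulr0 sin0 add0r.
Qed.

(** Origin of the quartic: with x^2 = 12 t^2, the polynomial factor is 9 (x^4 - 6 x^2 + 3), the
    fourth Hermite polynomial up to scale. *)
Lemma gmoment4_cos t :
  gmoment 4 (cosw t) = 27 * (1 - 24 * t ^+ 2 + 48 * t ^+ 4) * gmoment 0 (cosw t).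
Proof.
rewrite gmoment_cos gmoment_sin gmoment_cos gmoment1_sin.
by move: (gmoment 0 _) => c; ring.
Qed.

Definition gmom (k : nat) : R := gmoment k (fun=> 1).

Lemma gmom_cosw0 k : gmoment k (cosw 0) = gmom k.
Proof. by apply: eq_Rintegral => v _; rewrite /cosw mulr0 mul0r cos0. Qed.

Lemma gmomS k : gmom k.+2 = 3 * k.+1%:R * gmom k.
Proof. by rewrite -!gmom_cosw0 gmoment_cos; ring. Qed.

End gaussian.

(** * Fourier transform of the Gaussian and its first moments *)

Section gaussian_transform.
Context {R : realType}.
Local Notation leb := (@lebesgue_measure R).
Local Notation TR := (measurableTypeR R).
Local Notation D := (`]0%R, +oo[%classic : set R).

Lemma is_derive_gmoment0_cos (t : R) :
  is_derive t (1 : R) (fun t => gmoment 0 (cosw t)) (- 2 * gmoment 1 (sinw t)).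
Proof.
pose f (x v : R) := v ^+ 0 * gauss6 v * cosw x v.
(* The absolute value is there because the majorant must be nonnegative on the whole line, not only
   for v > 0. *)
pose G (v : R) := 2 * (`|v| ^+ 1 * gauss6 v * 1).
have tI : `]t - 1, t + 1[%classic t by rewrite /= in_itv/=; apply/andP; split; lra.
have d1 (x v : R) : is_derive x (1 : R) (f ^~ v) (- 2 * (v ^+ 1 * gauss6 v * sinw x v)).
  by rewrite /f /cosw /sinw; derive_auto; rewrite expr0 expr1; ring.
have intf (x : R) : `]t - 1, t + 1[%classic x -> leb.-integrable D (EFin \o f x).
  by move=> _; apply: integrable_gmoment (@norm_cosw _ x); exact: continuous_cosw.
have derf (x v : R) : `]t - 1, t + 1[%classic x -> D v -> derivable (f ^~ v) x 1.
  by move=> _ _; have [] := d1 x v.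
have G0 v : 0 <= G v by rewrite /G !mulr_ge0 ?expR_ge0 ?exprn_ge0.
have one1 (v : R) : 0 <= v -> `|1| <= 1 :> R by rewrite normr1.
have I1 := integrable_gmoment 1 (@cst_continuous R R 1) one1.
have iG : leb.-integrable D (EFin \o G).
  have := integrableZl (@measurable_half_line R) 2 I1.
  apply: eq_integrable => // v; rewrite inE/= in_itv/= andbT => v0.
  by rewrite -EFinM /G (gtr0_norm v0).
have pE (x v : R) : partial1of2 f x v = - 2 * (v ^+ 1 * gauss6 v * sinw x v).
  by rewrite /partial1of2 derive1E; have [] := d1 x v.
have Gub (x v : R) : `]t - 1, t + 1[%classic x -> D v -> `|partial1of2 f x v| <= G v.
  move=> _ _; rewrite pE /G normrM normrN (@ger0_norm _ 2)// ler_wpM2l//.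
  rewrite !normrM normrX (ger0_norm (gauss6_ge0 v)).
  by rewrite ler_wpM2l ?mulr_ge0 ?exprn_ge0 ?gauss6_ge0// sin_max.
have mD := @measurable_half_line R.
have dd := derivable_under_integral mD tI intf derf G0 iG Gub.
have de := differentiation_under_integral mD tI intf derf G0 iG Gub.
have E : \int[leb]_(v in D) partial1of2 f t v = - 2 * gmoment 1 (sinw t).
  rewrite /gmoment -RintegralZl//.
    by apply: eq_Rintegral => v _; rewrite pE.
  by apply: integrable_gmoment (@norm_sinw _ t); exact: continuous_sinw.
by apply: DeriveDef; [exact: dd|rewrite -derive1E -E; exact: de].
Qed.

(** Integration by parts turns the derivative in t into - 12 t times the transform, so its product
    with e^(6 t^2) is constant. *)
Lemma gmoment0_cos (t : R) : gmoment 0 (cosw t) = expR (- (6 * t ^+ 2)) * gmom 0.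
Proof.
pose h (x : R) := expR (6 * x ^+ 2) * gmoment 0 (cosw x).
have dh (x : R) : is_derive x (1 : R) h 0.
  have dE : is_derive x (1 : R) (fun x : R => expR (6 * x ^+ 2)) (12 * x * expR (6 * x ^+ 2)).
    by derive_auto; ring.
  apply: is_derive_eq (is_deriveM dE (is_derive_gmoment0_cos x)) _.
  by rewrite /GRing.scale/= gmoment1_sin; ring.
have := @is_derive_0_is_cst _ h t 0 dh.
rewrite /h expr0n mulr0 expR0 mul1r gmom_cosw0 => <-.
by rewrite mulrA -expRD addNr expR0 mul1r.
Qed.

Lemma integrable_gmom k : leb.-integrable D (EFin \o (fun v : R => v ^+ k * gauss6 v)).
Proof.
have one1 (v : R) : 0 <= v -> `|1| <= 1 :> R by rewrite normr1.
have := integrable_gmoment k (@cst_continuous R R 1) one1.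
by apply: eq_integrable => // v _; rewrite /= mulr1.
Qed.

Lemma gmomE k : gmom k = \int[leb]_(v in D) (v ^+ k * gauss6 v).
Proof. by apply: eq_Rintegral => v _; rewrite mulr1. Qed.

Lemma gmom1 : gmom 1 = 3 :> R.
Proof.
have one1 (v : R) : 0 <= v -> `|1| <= 1 :> R by rewrite normr1.
have zero1 (v : R) : 0 <= v -> `|0 : R| <= 1 by rewrite normr0.
have d1 (v : R) : is_derive v (1 : R) (fun=> 1 : R) (0 : R) by exact: is_derive_cst.
rewrite /gmom (gmoment_parts0 d1 (@cst_continuous R R 0) one1 zero1).
have -> : gmoment 0 (fun=> 0 : R) = 0; last by rewrite addr0 mulr1.
by rewrite /gmoment; under eq_Rintegral do rewrite mulr0; rewrite Rintegral_cst ?mul0r.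
Qed.

(* From v <= 1 + v ^ 2 / 4, the first moment 3 is at most (1 + 3 / 4) times the
   moment of order 0. *)
Lemma gmom0_ge : 12 / 7 <= gmom 0 :> R.
Proof.
have I0 := integrable_gmom 0; have I1 := integrable_gmom 1; have I2 := integrable_gmom 2.
have mD := @measurable_half_line R.
have Z a k : leb.-integrable D (EFin \o (fun v : R => a * (v ^+ k * gauss6 v))).
  have := integrableZl mD a (integrable_gmom k).
  by apply: eq_integrable => // v _; rewrite /= EFinM.
have I0' : leb.-integrable D (EFin \o @gauss6 R).
  by move: I0; apply: eq_integrable => // v _; rewrite /= expr0 mul1r.
have I02 : leb.-integrable D (EFin \o (fun v : R => gauss6 v + 4^-1 * (v ^+ 2 * gauss6 v))).
  by have := integrableD mD I0' (Z 4^-1 2%N).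
have : gmom 1 <= \int[leb]_(v in D) (gauss6 v + 4^-1 * (v ^+ 2 * gauss6 v)).
  rewrite gmomE; apply: le_Rintegral => // v _.
  have := gauss6_ge0 v; have := sqr_ge0 (v - 2).
  by rewrite expr1 => h1 h2; have := mulr_ge0 h1 h2; lra.
rewrite RintegralD// RintegralZl//.
have -> : \int[leb]_(v in D) gauss6 v = gmom 0.
  by rewrite gmomE; apply: eq_Rintegral => v _; rewrite expr0 mul1r.
rewrite -gmomE gmomS gmom1.
by move: (gmom 0) => g; lra.
Qed.

End gaussian_transform.

(** * Comparison of sinc powers with the Gaussian *)

(* The values of sin and cos are generalized since field would unfold them. *)
Ltac derive_trig :=
  derive_auto;
  repeat match goal with |- context [sin ?a] => generalize (sin a); intro end;
  repeat match goal with |- context [cos ?a] => generalize (cos a); intro end.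

Ltac taylor_at0 e :=
  by cbv beta; rewrite e !(exprS 0, mul0r, subr0, addr0, subrr) lexx.

Section sinc_expansion.
Context {R : realType}.
Implicit Types x y z : R.

(** Each difference vanishes at 0 and has the previous one as derivative, so nonnegativity climbs
    the chain. *)
Lemma expRN_taylor4_5 : forall z, 0 <= z ->
  1 - z + z ^+ 2 / 2 - z ^+ 3 / 6 + z ^+ 4 / 24 - z ^+ 5 / 120 <= expR (- z) /\
  expR (- z) <= 1 - z + z ^+ 2 / 2 - z ^+ 3 / 6 + z ^+ 4 / 24.
Proof.
have d1 : forall z, is_derive z (1 : R) (fun z => expR (- z) - (1 - z)) (1 - expR (- z)).
  by clear; move=> ?; derive_trig; ring.
have d2 : forall z, is_derive z (1 : R) (fun z => 1 - z + z ^+ 2 / 2 - expR (- z)) (expR (- z) - (1 - z)).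
  by clear; move=> ?; derive_trig; field.
have d3 : forall z, is_derive z (1 : R) (fun z => expR (- z) - (1 - z + z ^+ 2 / 2 - z ^+ 3 / 6))
    (1 - z + z ^+ 2 / 2 - expR (- z)).
  by clear; move=> ?; derive_trig; field.
have d4 : forall z, is_derive z (1 : R)
    (fun z => 1 - z + z ^+ 2 / 2 - z ^+ 3 / 6 + z ^+ 4 / 24 - expR (- z))
    (expR (- z) - (1 - z + z ^+ 2 / 2 - z ^+ 3 / 6)).
  by clear; move=> ?; derive_trig; field.
have d5 : forall z, is_derive z (1 : R)
    (fun z => expR (- z) - (1 - z + z ^+ 2 / 2 - z ^+ 3 / 6 + z ^+ 4 / 24 - z ^+ 5 / 120))
    (1 - z + z ^+ 2 / 2 - z ^+ 3 / 6 + z ^+ 4 / 24 - expR (- z)).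
  by clear; move=> ?; derive_trig; field.
have p0 z : 0 <= z -> 0 <= 1 - expR (- z) by move=> z0; rewrite subr_ge0 expR_le1 oppr_le0.
have e0 : expR (- 0) = 1 :> R by rewrite oppr0 expR0.
have p1 := ge0_from_derive d1 ltac:(taylor_at0 e0) p0.
have p2 := ge0_from_derive d2 ltac:(taylor_at0 e0) p1.
have p3 := ge0_from_derive d3 ltac:(taylor_at0 e0) p2.
have p4 := ge0_from_derive d4 ltac:(taylor_at0 e0) p3.
have p5 := ge0_from_derive d5 ltac:(taylor_at0 e0) p4.
by move=> z z0; split; rewrite -subr_ge0; [exact: p5|exact: p4].
Qed.

(** Same chain as for the exponential. Order 9 is chosen so that sinc is enclosed up to a term in
    x^8, the order of the remainder in its logarithm. *)
Lemma sin_taylor : forall x, 0 <= x ->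
  x - x ^+ 3 / 6 + x ^+ 5 / 120 - x ^+ 7 / (24 * 30 * 7) <= sin x /\
  sin x <= x - x ^+ 3 / 6 + x ^+ 5 / 120 - x ^+ 7 / (24 * 30 * 7) + x ^+ 9 / (24 * 30 * (21 * 24)).
Proof.
have d1 : forall x, is_derive x (1 : R) (fun x => x - sin x) (1 - cos x) by clear; move=> ?; derive_auto.
have d2 : forall x, is_derive x (1 : R) (fun x => cos x - (1 - x ^+ 2 / 2)) (x - sin x).
  by clear; move=> ?; derive_trig; field.
have d3 : forall x, is_derive x (1 : R) (fun x => sin x - (x - x ^+ 3 / 6)) (cos x - (1 - x ^+ 2 / 2)).
  by clear; move=> ?; derive_trig; field.
have d4 : forall x, is_derive x (1 : R) (fun x => 1 - x ^+ 2 / 2 + x ^+ 4 / 24 - cos x)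
    (sin x - (x - x ^+ 3 / 6)).
  by clear; move=> ?; derive_trig; field.
have d5 : forall x, is_derive x (1 : R) (fun x => x - x ^+ 3 / 6 + x ^+ 5 / 120 - sin x)
    (1 - x ^+ 2 / 2 + x ^+ 4 / 24 - cos x).
  by clear; move=> ?; derive_trig; field.
have d6 : forall x, is_derive x (1 : R)
    (fun x => cos x - (1 - x ^+ 2 / 2 + x ^+ 4 / 24 - x ^+ 6 / (24 * 30)))
    (x - x ^+ 3 / 6 + x ^+ 5 / 120 - sin x).
  by clear; move=> ?; derive_trig; field.
have d7 : forall x, is_derive x (1 : R)
    (fun x => sin x - (x - x ^+ 3 / 6 + x ^+ 5 / 120 - x ^+ 7 / (24 * 30 * 7)))
    (cos x - (1 - x ^+ 2 / 2 + x ^+ 4 / 24 - x ^+ 6 / (24 * 30))).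
  by clear; move=> ?; derive_trig; field.
have d8 : forall x, is_derive x (1 : R)
    (fun x => 1 - x ^+ 2 / 2 + x ^+ 4 / 24 - x ^+ 6 / (24 * 30) + x ^+ 8 / (24 * 30 * (7 * 8)) - cos x)
    (sin x - (x - x ^+ 3 / 6 + x ^+ 5 / 120 - x ^+ 7 / (24 * 30 * 7))).
  by clear; move=> ?; derive_trig; field.
have d9 : forall x, is_derive x (1 : R)
    (fun x => x - x ^+ 3 / 6 + x ^+ 5 / 120 - x ^+ 7 / (24 * 30 * 7) + x ^+ 9 / (24 * 30 * (21 * 24)) - sin x)
    (1 - x ^+ 2 / 2 + x ^+ 4 / 24 - x ^+ 6 / (24 * 30) + x ^+ 8 / (24 * 30 * (7 * 8)) - cos x).
  by clear; move=> ?; derive_trig; field.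
have p0 x : 0 <= x -> 0 <= 1 - cos x by move=> _; rewrite subr_ge0 cos_le1.
have z0 := @sin0 R; have z1 := @cos0 R.
have p1 := ge0_from_derive d1 ltac:(taylor_at0 z0) p0.
have p2 := ge0_from_derive d2 ltac:(taylor_at0 z1) p1.
have p3 := ge0_from_derive d3 ltac:(taylor_at0 z0) p2.
have p4 := ge0_from_derive d4 ltac:(taylor_at0 z1) p3.
have p5 := ge0_from_derive d5 ltac:(taylor_at0 z0) p4.
have p6 := ge0_from_derive d6 ltac:(taylor_at0 z1) p5.
have p7 := ge0_from_derive d7 ltac:(taylor_at0 z0) p6.
have p8 := ge0_from_derive d8 ltac:(taylor_at0 z1) p7.
have p9 := ge0_from_derive d9 ltac:(taylor_at0 z0) p8.
by move=> x x0; split; rewrite -subr_ge0; [exact: p7|exact: p9].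
Qed.

Lemma expr_ge0_le1 y (m n : nat) : 0 <= y <= 1 -> (m <= n)%N -> 0 <= y ^+ n <= y ^+ m.
Proof.
by move=> /andP[y0 y1] mn; rewrite exprn_ge0//= ler_wiXn2l.
Qed.

(* 1 / (45 * 63) = 1 / 2835 is the coefficient of x ^ 6 in - ln (sinc x);
   large numerals are written as products because they are unary. *)
Lemma sinc_expansion x : 0 < x -> x ^+ 2 <= 1 ->
  exists2 th, 0 <= th <= (x ^+ 2) ^+ 4 / (200 * 100) &
  sinc x = expR (- (x ^+ 2 / 6 + (x ^+ 2) ^+ 2 / 180 + (x ^+ 2) ^+ 3 / (45 * 63) + th)).
Proof.
move=> x0; set y := x ^+ 2 => y1.
have y0 : 0 <= y by exact: sqr_ge0.
have y01 : 0 <= y <= 1 by rewrite y0.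
have yk k := @expr_ge0_le1 y 4 k y01.
have [/= sl su] := sin_taylor (ltW x0).
have [yl yu] : 1 - y / 6 + y ^+ 2 / 120 - y ^+ 3 / (24 * 30 * 7) <= sinc x /\
    sinc x <= 1 - y / 6 + y ^+ 2 / 120 - y ^+ 3 / (24 * 30 * 7) + y ^+ 4 / (24 * 30 * (21 * 24)).
  rewrite /sinc /y ler_pdivlMr// ler_pdivrMr//; split.
    by apply: le_trans sl; rewrite le_eqVlt; apply/orP; left; apply/eqP; ring.
  by apply: (le_trans su); rewrite le_eqVlt; apply/orP; left; apply/eqP; ring.
(* Substituting polynomials of degree 3 and 4 in y into the Taylor bounds produces powers up to
   y^16; bounding those above y^4 by y^4 makes the comparison linear in y, ..., y^4. *)
have h5 := yk 5%N isT; have h6 := yk 6%N isT; have h7 := yk 7%N isT.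
have h8 := yk 8%N isT; have h9 := yk 9%N isT; have h10 := yk 10%N isT.
have h11 := yk 11%N isT; have h12 := yk 12%N isT; have h13 := yk 13%N isT.
have h14 := yk 14%N isT; have h15 := yk 15%N isT; have h16 := yk 16%N isT.
have h2 : 0 <= y ^+ 2 by rewrite sqr_ge0.
have h3 : 0 <= y ^+ 3 by rewrite exprn_ge0.
have h4 : 0 <= y ^+ 4 by rewrite exprn_ge0.
pose z0 := y / 6 + y ^+ 2 / 180 + y ^+ 3 / (45 * 63).
(* The coefficient of y^4 in - ln sinc is 1/37800; 1/20000 leaves room for all higher terms up to y
   = 1. *)
pose z1 := z0 + y ^+ 4 / (200 * 100).
have z00 : 0 <= z0 by rewrite /z0; lra.
have z10 : 0 <= z1 by rewrite /z1; lra.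
have U : sinc x <= expR (- z0).
  apply: (le_trans yu); have [+ _] := expRN_taylor4_5 z00; apply: le_trans.
  by rewrite /z0; lra.
have L : expR (- z1) <= sinc x.
  apply: le_trans yl; have [_ +] := expRN_taylor4_5 z10; move/le_trans; apply.
  by rewrite /z1 /z0; lra.
have s0 : 0 < sinc x by apply: lt_le_trans L; exact: expR_gt0.
exists (- ln (sinc x) - z0).
  have U' : ln (sinc x) <= - z0 by rewrite -[leRHS]expRK ler_ln// posrE expR_gt0.
  have L' : - z1 <= ln (sinc x) by rewrite -[leLHS]expRK ler_ln// posrE expR_gt0.
  by move: U' L'; rewrite /z1; move: (ln _) => w U' L'; apply/andP; split; lra.
by rewrite -/z0 addrC subrK opprK lnK// posrE.
Qed.

End sinc_expansion.

(** * Perturbation of the exponent between consecutive dimensions *)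

Section pointwise.
Context {R : realType}.
Implicit Types (u v x N M b e : R).

(** By convexity the difference of the exponentials lies between (b - b') e^(-b) and (b - b')
    e^(-b'), and both factors lie in [1 - m, 1]. *)
Lemma expRN_diff_le b b' m : 0 <= b <= m -> 0 <= b' <= m ->
  `|expR (- b') - expR (- b) - (b - b')| <= `|b - b'| * m.
Proof.
move=> /andP[b0 bm] /andP[b'0 b'm].
have e1 (c : R) : 0 <= c -> 0 < expR (- c) <= 1.
  by move=> c0; rewrite expR_gt0 expR_le1 oppr_le0.
have e2 (c : R) : 1 - c <= expR (- c) by have := expR_ge1Dx (- c).
have h1 : expR (- b) * (b - b') <= expR (- b') - expR (- b).
  have := expR_ge1Dx (b - b'); have /andP[+ _] := e1 _ b0.
  move=> p0 /(ler_wpM2l (ltW p0)); rewrite -expRD (_ : - b + (b - b') = - b'); last by ring.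
  by move=> h; lra.
have h2 : expR (- b') - expR (- b) <= expR (- b') * (b - b').
  have := expR_ge1Dx (b' - b); have /andP[+ _] := e1 _ b'0.
  move=> p0 /(ler_wpM2l (ltW p0)); rewrite -expRD (_ : - b' + (b' - b) = - b); last by ring.
  by move=> h; lra.
have /andP[p1 p2] := e1 _ b0; have /andP[p1' p2'] := e1 _ b'0.
have q1 := e2 b; have q1' := e2 b'.
move: (expR (- b)) (expR (- b')) h1 h2 p1 p2 p1' p2' q1 q1' => E E' h1 h2 p1 p2 p1' p2' q1 q1'.
have [d0|d0] := leP 0 (b - b').
  rewrite (ger0_norm d0) ler_norml; apply/andP; split.
    have : 0 <= (b - b') * (m - (1 - E)) by rewrite mulr_ge0//; lra.
    by lra.
  have : 0 <= (b - b') * (m + (1 - E')) by rewrite mulr_ge0//; lra.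
  by lra.
rewrite (ltr0_norm d0) ler_norml; apply/andP; split.
  have : 0 <= (b' - b) * (m + (1 - E)) by rewrite mulr_ge0//; lra.
  by lra.
have : 0 <= (b' - b) * (m - (1 - E')) by rewrite mulr_ge0//; lra.
by lra.
Qed.

(** With u = v^2 and x^2 = u / N, this is N times the part of - ln (sinc x) beyond x^2/6; e stands
    for N times the remainder. *)
Definition exponent N u e : R := u ^+ 2 / (180 * N) + u ^+ 3 / (45 * 63 * N ^+ 2) + e.

(** With y = u / N <= 1 the higher terms are controlled by the first one, and 1 + 180/2835 +
    180/20000 < 27/25. *)
Lemma exponent_bounds N u e : 136 <= N -> 0 <= u <= N ->
  0 <= e <= u ^+ 4 / (200 * 100 * N ^+ 3) ->
  0 <= exponent N u e <= 27 / 25 * (u ^+ 2 / (180 * N)).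
Proof.
move=> N136 /andP[u0 uN] /andP[e0 eu].
have N0 : 0 < N by lra.
have Nn := lt0r_neq0 N0.
pose y := u / N.
have y0 : 0 <= y by rewrite divr_ge0// ltW.
have y1 : y <= 1 by rewrite ler_pdivrMr// mul1r.
have uE : u = y * N by rewrite divfK.
have A : u ^+ 2 / (180 * N) = y ^+ 2 * N / 180 by rewrite uE; field.
have B : u ^+ 3 / (45 * 63 * N ^+ 2) = y ^+ 3 * N / (45 * 63) by rewrite uE; field.
have C : u ^+ 4 / (200 * 100 * N ^+ 3) = y ^+ 4 * N / (200 * 100) by rewrite uE; field.
rewrite C in eu; rewrite /exponent A B.
have a0 : 0 <= y ^+ 2 * N by rewrite mulr_ge0 ?sqr_ge0// ltW.
have b0 : 0 <= y ^+ 3 * N by rewrite mulr_ge0 ?exprn_ge0// ltW.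
have ba : y ^+ 3 * N <= y ^+ 2 * N by rewrite ler_wpM2r ?(ltW N0)// ler_wiXn2l.
have ca : y ^+ 4 * N <= y ^+ 2 * N by rewrite ler_wpM2r ?(ltW N0)// ler_wiXn2l.
by apply/andP; split; lra.
Qed.

(** The u^2 terms differ by exactly the main term. The u^3 terms gain a factor (2 N + 1) / (N + 1) <
    2 after scaling. The remainders are bounded rather than compared, and 137/136 turns 1/20000 into
    less than 1/19800. *)
Lemma exponent_diff_le N u e e' : 136 <= N -> 0 <= u <= N ->
  0 <= e <= u ^+ 4 / (200 * 100 * N ^+ 3) ->
  0 <= e' <= u ^+ 4 / (200 * 100 * (N + 1) ^+ 3) ->
  `|exponent N u e - exponent (N + 1) u e' - u ^+ 2 / (180 * N * (N + 1))| *
    (N ^+ 2 * (N + 1)) <= 2 / (45 * 63) * u ^+ 3 + u ^+ 4 / (198 * 100).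
Proof.
move=> N136 /andP[u0 uN] /andP[e0 eu] /andP[e'0 e'u].
have N0 : 0 < N by lra.
have M0 : 0 < N + 1 by lra.
have Nn := lt0r_neq0 N0; have Mn := lt0r_neq0 M0.
have -> : exponent N u e - exponent (N + 1) u e' - u ^+ 2 / (180 * N * (N + 1)) =
    u ^+ 3 / (45 * 63) * ((2 * N + 1) / (N ^+ 2 * (N + 1) ^+ 2)) + (e - e').
  by rewrite /exponent; field; rewrite Nn Mn.
have D0 : 0 < N ^+ 2 * (N + 1) by rewrite mulr_gt0 ?exprn_gt0.
rewrite -[X in _ * X](gtr0_norm D0) -normrM mulrDl.
apply: le_trans (ler_normD _ _) _; apply: lerD.
  rewrite ger0_norm; last first.
    by rewrite !mulr_ge0 ?invr_ge0 ?mulr_ge0 ?exprn_ge0 ?(ltW N0) ?(ltW M0)//; lra.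
  rewrite [leLHS](_ : _ = u ^+ 3 / (45 * 63) * ((2 * N + 1) / (N + 1))); last first.
    by field; rewrite Nn Mn.
  rewrite [leRHS](_ : _ = u ^+ 3 / (45 * 63) * 2); last by ring.
  rewrite ler_wpM2l ?divr_ge0 ?exprn_ge0// ler_pdivrMr//; lra.
have u4 : 0 <= u ^+ 4 by rewrite exprn_ge0.
rewrite normrM (gtr0_norm D0).
have ee : `|e - e'| <= u ^+ 4 / (200 * 100 * N ^+ 3).
  have : u ^+ 4 / (200 * 100 * (N + 1) ^+ 3) <= u ^+ 4 / (200 * 100 * N ^+ 3).
    rewrite ler_wpM2l// lef_pV2 ?posrE ?mulr_gt0 ?exprn_gt0//.
    by rewrite ler_wpM2l// lerXn2r ?nnegrE ?(ltW N0) ?(ltW M0)//; lra.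
  by rewrite ler_norml => h; apply/andP; split; lra.
apply: (le_trans (ler_wpM2r (ltW D0) ee)).
rewrite [leLHS](_ : _ = u ^+ 4 / (200 * 100) * ((N + 1) / N)); last by field.
rewrite -mulrA ler_wpM2l// -ler_pdivlMl// ler_pdivrMr//; lra.
Qed.

Lemma central_estimate N u e e' : 136 <= N -> 0 <= u <= N ->
  0 <= e <= u ^+ 4 / (200 * 100 * N ^+ 3) ->
  0 <= e' <= u ^+ 4 / (200 * 100 * (N + 1) ^+ 3) ->
  `|expR (- exponent (N + 1) u e') - expR (- exponent N u e)
     - u ^+ 2 / (180 * N * (N + 1))| * (N ^+ 2 * (N + 1)) <=
  u ^+ 3 / (14 * 100) + u ^+ 4 / (100 * 100) + u ^+ 5 / (400 * 400 * 100)
   + u ^+ 6 / (100 * 100 * 100 * 100).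
Proof.
move=> N136 uN he he'.
have N0 : 0 < N by lra.
have M0 : 0 < N + 1 by lra.
have Nn := lt0r_neq0 N0; have Mn := lt0r_neq0 M0.
have D0 : 0 < N ^+ 2 * (N + 1) by rewrite mulr_gt0 ?exprn_gt0.
have /andP[u0 uN'] := uN.
have W := exponent_diff_le N136 uN he he'.
have hb := exponent_bounds N136 uN he.
have hb' : 0 <= exponent (N + 1) u e' <= 27 / 25 * (u ^+ 2 / (180 * N)).
  have := @exponent_bounds (N + 1) u e' _ _ he'.
  move=> /(_ _ _)/andP[||-> h]; [lra|by apply/andP; split; lra|].
  apply: (le_trans h); rewrite ler_wpM2l// ler_wpM2l ?sqr_ge0//.
  by rewrite lef_pV2 ?posrE ?mulr_gt0//; lra.
set m := 27 / 25 * _ in hb hb'.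
have := expRN_diff_le hb hb'.
move: (exponent N u e) (exponent (N + 1) u e') W => b b' W X.
set a := u ^+ 2 / (180 * N * (N + 1)) in W *.
have a0 : 0 <= a by rewrite divr_ge0 ?sqr_ge0// !mulr_ge0 ?ltW.
have m0 : 0 <= m by have /andP[] := hb; lra.
have db : `|b - b'| <= a + `|b - b' - a|.
  by rewrite -{1}(subrK a (b - b')) addrC (le_trans (ler_normD _ _))// (ger0_norm a0).
(* Two errors add up: that of the exponents, and that of replacing the exponential by its linear
   part, at most m |b - b'|. *)
have Y : `|expR (- b') - expR (- b) - a| <= `|b - b' - a| + (a + `|b - b' - a|) * m.
  rewrite (_ : _ - a = (expR (- b') - expR (- b) - (b - b')) + (b - b' - a)); last by ring.
  rewrite (le_trans (ler_normD _ _))// addrC lerD2l (le_trans X)// ler_wpM2r//.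
move: (`|b - b' - a|) W Y => w W Y.
apply: (le_trans (ler_wpM2r (ltW D0) Y)).
rewrite [leLHS](_ : _ = w * (N ^+ 2 * (N + 1)) * (1 + m) + a * (N ^+ 2 * (N + 1)) * m); last by ring.
have -> : a * (N ^+ 2 * (N + 1)) * m = 27 / 25 * (u ^+ 4 / (180 * 180)).
  by rewrite /a /m; field; rewrite Nn Mn.
(* Here N >= 136 bounds m by a multiple of u^2 free of N; expanding and rounding the coefficients up
   gives the four terms of the bound. *)
have m1 : m <= 27 / 25 * (u ^+ 2 / (180 * 136)).
  rewrite /m ler_wpM2l// ler_wpM2l ?sqr_ge0// lef_pV2 ?posrE ?mulr_gt0//.
  by rewrite ler_wpM2l.
have u3 : 0 <= u ^+ 3 by rewrite exprn_ge0.
have u4 : 0 <= u ^+ 4 by rewrite exprn_ge0.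
have u5 : 0 <= u ^+ 5 by rewrite exprn_ge0.
have u6 : 0 <= u ^+ 6 by rewrite exprn_ge0.
have m2 : 0 <= 1 + m by lra.
have r0 : 0 <= 2 / (45 * 63) * u ^+ 3 + u ^+ 4 / (198 * 100) by lra.
have := ler_wpM2r m2 W.
have : (2 / (45 * 63) * u ^+ 3 + u ^+ 4 / (198 * 100)) * (1 + m) <=
  (2 / (45 * 63) * u ^+ 3 + u ^+ 4 / (198 * 100)) * (1 + 27 / 25 * (u ^+ 2 / (180 * 136))).
  by rewrite ler_wpM2l// lerD2l.
move: (w * _ * _) => z h1 h2; lra.
Qed.

End pointwise.

(** * Integrands for v^2 <= n and in the tail *)

Section final_estimate.
Context {R : realType}.
Local Notation leb := (@lebesgue_measure R).
Local Notation TR := (measurableTypeR R).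
Local Notation D := (`]0%R, +oo[%classic : set R).
Local Notation N n := (n%:R : R).
Implicit Types (n k : nat) (v x : R).

Definition sincpow (n : nat) (v : R) : R := sinc (v / Num.sqrt n%:R) ^+ n.

Definition main_term (n : nat) (v : R) : R :=
  v ^+ 4 * gauss6 v / (180 * N n * (N n + 1)).

Lemma sincpow_central n v : (0 < n)%N -> 0 < v -> v ^+ 2 <= N n ->
  exists2 e, 0 <= e <= (v ^+ 2) ^+ 4 / (200 * 100 * N n ^+ 3) &
  sincpow n v = gauss6 v * expR (- exponent (N n) (v ^+ 2) e).
Proof.
move=> n0 v0 vN; have N0 : 0 < N n by rewrite ltr0n.
have Nn := lt0r_neq0 N0.
have r0 : 0 < Num.sqrt (N n) by rewrite sqrtr_gt0.
have x0 : 0 < v / Num.sqrt (N n) by rewrite divr_gt0.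
have x2 : (v / Num.sqrt (N n)) ^+ 2 = v ^+ 2 / N n.
  by rewrite expr_div_n sqr_sqrtr// ltW.
have := sinc_expansion x0; rewrite x2 ler_pdivrMr// mul1r => /(_ vN)[th /andP[th0 thu] E].
exists (th * N n).
  rewrite mulr_ge0 ?(ltW N0)//=.
  apply: (le_trans (ler_wpM2r (ltW N0) thu)).
  by rewrite le_eqVlt; apply/orP; left; apply/eqP; field.
rewrite /sincpow E -expRM_natl /gauss6 -expRD; congr expR.
by rewrite /exponent; field.
Qed.

Lemma sincpow_diff_central n v : (136 <= n)%N -> 0 < v -> v ^+ 2 <= N n ->
  `|sincpow n.+1 v - sincpow n v - main_term n v| * (N n ^+ 2 * (N n + 1)) <=
  gauss6 v * (v ^+ 6 / (14 * 100) + v ^+ 8 / (100 * 100) + v ^+ 10 / (400 * 400 * 100)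
   + v ^+ 12 / (100 * 100 * 100 * 100)).
Proof.
move=> n136 v0 vN; have N136 : 136 <= N n by rewrite (ler_nat R 136).
have [e he ->] := sincpow_central (leq_trans (isT : 0 < 136)%N n136) v0 vN.
have vN1 : v ^+ 2 <= N n.+1 by rewrite (le_trans vN)// ler_nat.
have [e' he' ->] := sincpow_central (ltn0Sn n) v0 vN1.
have SN : N n.+1 = N n + 1 by rewrite -natr1.
rewrite SN in he' *.
have hu : 0 <= v ^+ 2 <= N n by rewrite sqr_ge0.
have := central_estimate N136 hu he he'.
have -> : main_term n v = gauss6 v * ((v ^+ 2) ^+ 2 / (180 * N n * (N n + 1))).
  by rewrite /main_term -exprM mulrCA -mulrA.
rewrite -!mulrBr normrM (ger0_norm (gauss6_ge0 v)) => h.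
rewrite -[leLHS]mulrA ler_wpM2l ?gauss6_ge0//; apply: (le_trans h).
by rewrite -!exprM.
Qed.

(** The threshold is n/(n+1) at n = 136, where sinc is already just below 27/32. Taylor bounds
    handle x <= 2, and |sin| <= 1 the rest. *)
Lemma norm_sinc_far x : 136 / 137 <= x ^+ 2 -> 0 < x -> `|sinc x| <= 27 / 32.
Proof.
move=> xl x0; have [x2|x2] := leP x 2; last first.
  rewrite /sinc normrM normfV (gtr0_norm x0) ler_pdivrMr//.
  by apply: le_trans (sin_max x) _; lra.
have y4 : x ^+ 2 <= 4.
  by rewrite (_ : 4 = 2 ^+ 2) ?lerXn2r ?nnegrE ?(ltW x0)//; rewrite expr2; lra.
have [sl su] := sin_taylor (ltW x0).
set y := x ^+ 2 in xl y4; have y0 : 0 <= y by exact: sqr_ge0.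
have E3 : x ^+ 3 = x * y by rewrite /y; ring.
have E5 : x ^+ 5 = x * y ^+ 2 by rewrite /y; ring.
have E7 : x ^+ 7 = x * y ^+ 3 by rewrite /y; ring.
have E9 : x ^+ 9 = x * y ^+ 4 by rewrite /y; ring.
(* Chord of the parabola over [136/137, 4], a linear bound for y^2. *)
have y2 : y ^+ 2 <= (136 / 137 + 4) * y - 136 / 137 * 4.
  have : 0 <= (y - 136 / 137) * (4 - y) by rewrite mulr_ge0//; lra.
  by lra.
have y3 : 0 <= y ^+ 3 by rewrite exprn_ge0.
have y34 : y ^+ 4 <= 4 * y ^+ 3 by rewrite exprS ler_wpM2r.
have y23 : y ^+ 3 <= 4 * y ^+ 2 by rewrite exprS ler_wpM2r// sqr_ge0.
have y22 : y ^+ 2 <= 4 * y by rewrite expr2 ler_wpM2r.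
have y20 : 0 <= y ^+ 2 by rewrite sqr_ge0.
rewrite /sinc normrM normfV (gtr0_norm x0) ler_pdivrMr//.
rewrite E3 E5 E7 E9 in sl su.
rewrite ler_norml; apply/andP; split.
  apply: le_trans sl; rewrite -subr_ge0.
  rewrite [leRHS](_ : _ = x * (59 / 32 - y / 6 + y ^+ 2 / 120 - y ^+ 3 / (24 * 30 * 7))); last by field.
  by rewrite mulr_ge0 ?(ltW x0)//; lra.
apply: (le_trans su); rewrite -subr_ge0.
rewrite [leRHS](_ : _ = x * (27 / 32 - (1 - y / 6 + y ^+ 2 / 120 - y ^+ 3 / (24 * 30 * 7) + y ^+ 4 / (24 * 30 * (21 * 24))))); last by field.
by rewrite mulr_ge0 ?(ltW x0)//; lra.
Qed.

(** Two factors sinc are kept for integrability in v; the others, at least n - 2 of them, give the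
    exponentially small constant. *)
Lemma sincpow_far n k v : (136 <= n)%N -> (n <= k <= n.+1)%N -> 0 < v -> N n < v ^+ 2 ->
  `|sincpow k v| <= (27 / 32) ^+ (n - 2) * (2 * (N k / (N k + v ^+ 2))).
Proof.
move=> n136 /andP[nk kn] v0 vN.
have n2 : (2 <= n)%N by apply: leq_trans n136.
have k2 : (2 <= k)%N by apply: leq_trans nk.
have k0 : 0 < N k by rewrite ltr0n (leq_trans _ k2).
have N136 : 136 <= N n by rewrite (ler_nat R 136).
have x0 : 0 < v / Num.sqrt (N k) by rewrite divr_gt0 ?sqrtr_gt0.
have x2 : (v / Num.sqrt (N k)) ^+ 2 = v ^+ 2 / N k.
  by rewrite expr_div_n sqr_sqrtr// ltW.
have kM : N k <= N n + 1 by rewrite natr1 ler_nat.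
have xl : 136 / 137 <= (v / Num.sqrt (N k)) ^+ 2.
  by rewrite x2 ler_pdivlMr//; lra.
have q := norm_sinc_far xl x0.
rewrite /sincpow -{2}(subnK k2) exprD normrM.
have -> : 2 * (N k / (N k + v ^+ 2)) = 2 / (1 + (v / Num.sqrt (N k)) ^+ 2).
  rewrite x2; field; rewrite lt0r_neq0//= lt0r_neq0//.
  by rewrite ltr_pwDl// sqr_ge0.
apply: ler_pM => //.
  rewrite normrX (le_trans (lerXn2r _ _ _ q)) ?nnegrE//.
  by apply: ler_wiXn2l; [lra|lra|exact: leq_sub2r].
by rewrite ger0_norm ?sqr_ge0// sqr_sinc_le// lt0r_neq0.
Qed.

(** For v^2 > n, the inequality v^8 >= n^4 >= 136^3 n trades the factor n for v^8, so the tail of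
    the main term fits into the v^12 term of the central bound. *)
Lemma main_term_far n v : (136 <= n)%N -> 0 < v -> N n < v ^+ 2 ->
  `|main_term n v| * (N n ^+ 2 * (N n + 1)) <= gauss6 v * (v ^+ 12 / (100 * 100 * 100 * 100)).
Proof.
move=> n136 v0 vN; have N136 : 136 <= N n by rewrite (ler_nat R 136).
have N0 : 0 < N n by lra. have M0 : 0 < N n + 1 by lra.
have Nn := lt0r_neq0 N0; have Mn := lt0r_neq0 M0.
rewrite ger0_norm; last first.
  by rewrite divr_ge0// ?mulr_ge0 ?exprn_ge0 ?gauss6_ge0 ?(ltW v0) ?(ltW N0) ?(ltW M0).
rewrite [leLHS](_ : _ = gauss6 v * (v ^+ 4 * N n / 180)); last first.
  by rewrite /main_term; field; rewrite Nn Mn.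
rewrite ler_wpM2l ?gauss6_ge0//.
have v4 : 0 <= v ^+ 4 by rewrite exprn_ge0// ltW.
have h2 : N n ^+ 4 <= (v ^+ 2) ^+ 4 by rewrite lerXn2r ?nnegrE ?(ltW N0) ?sqr_ge0// ltW.
have h3 : 136 ^+ 3 <= N n ^+ 3 by rewrite lerXn2r ?nnegrE ?(ltW N0).
have h4 : 136 ^+ 3 * N n <= N n ^+ 4 by rewrite (exprSr _ 3) ler_wpM2r// ltW.
have h5 := le_trans h4 h2.
have : N n / 180 <= (v ^+ 2) ^+ 4 / (100 * 100 * 100 * 100).
  by move: h5 N136; move: ((v ^+ 2) ^+ 4) (N n) => a b h5 N136; lra.
move/(ler_wpM2l v4); rewrite mulrA => /le_trans; apply.
by rewrite le_eqVlt; apply/orP; left; apply/eqP; ring.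
Qed.

(** Of the four factors n + 1, three come from the normalization n^2 (n + 1) and one from the
    integrals of the tail majorants, of order sqrt n. *)
Lemma tail_small n : (136 <= n)%N -> (N n + 1) ^+ 4 * (27 / 32) ^+ (n - 2) <= 1 / 10.
Proof.
elim: n => // n IH; rewrite leq_eqVlt => /predU1P[<-|].
  (* The exponent 134 is split as 16 * 8 + 6 to keep the arithmetic within reach; 137^4 (1/15)^8
     (2/5) is about 0.055. *)
  have q16 : (27 / 32) ^+ 16 <= 1 / 15 :> R by lra.
  rewrite (_ : (136 - 2)%N = (16 * 8 + 6)%N)// exprD exprM.
  have q128 : ((27 / 32) ^+ 16) ^+ 8 <= (1 / 15) ^+ 8 :> R.
    by rewrite lerXn2r ?nnegrE.
  have q60 : 0 <= (27 / 32 : R) ^+ 6 by rewrite exprn_ge0.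
  have q61 : (27 / 32 : R) ^+ 6 <= 2 / 5 by lra.
  rewrite (_ : 136%:R + 1 = 137); last by lra.
  have h : ((27 / 32) ^+ 16) ^+ 8 * (27 / 32) ^+ 6 <= (1 / 15) ^+ 8 * (2 / 5) :> R.
    by rewrite ler_pM//; do 2 apply: exprn_ge0; lra.
  have p137 : 0 <= 137 ^+ 4 :> R by rewrite exprn_ge0.
  by apply: (le_trans (ler_wpM2l p137 h)); lra.
rewrite ltnS => n136; have N136 : 136 <= N n by rewrite (ler_nat R 136).
apply: le_trans (IH n136).
rewrite -natr1 subSn ?(leq_trans _ n136)// (exprS (27 / 32)) mulrA ler_wpM2r ?exprn_ge0//.
have x0 : 0 <= (N n + 1) ^+ 4 by rewrite exprn_ge0//; lra.
(* The sequence decreases because (138/137)^4 (27/32) < 1. *)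
have : (N n + 1 + 1) ^+ 4 <= (138 / 137 * (N n + 1)) ^+ 4.
  by rewrite lerXn2r ?nnegrE//; lra.
by rewrite exprMn; move: ((N n + 1 + 1) ^+ 4) ((N n + 1) ^+ 4) x0 => a b; lra.
Qed.

End final_estimate.

(** * Sign of the difference *)

Section assembly.
Context {R : realType}.
Local Notation leb := (@lebesgue_measure R).
Local Notation TR := (measurableTypeR R).
Local Notation D := (`]0%R, +oo[%classic : set R).
Local Notation N n := (n%:R : R).
Implicit Types (n k : nat) (v x t : R).

(** Carrying integrability along with the value lets linear combinations be integrated without
    separate side conditions. *)
Definition has_int (f : R -> R) (I : R) : Prop :=
  leb.-integrable D (EFin \o f) /\ \int[leb]_(v in D) f v = I.

Lemma has_intD f g I J : has_int f I -> has_int g J ->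
  has_int (fun v => f v + g v) (I + J).
Proof.
move=> [If <-] [Ig <-]; split; last by rewrite RintegralD.
by have := integrableD (@measurable_half_line R) If Ig.
Qed.

Lemma has_intZ a f I : has_int f I -> has_int (fun v => a * f v) (a * I).
Proof.
move=> [If <-]; split; last by rewrite RintegralZl.
have := integrableZl (@measurable_half_line R) a If.
by apply: eq_integrable => // v _; rewrite /= EFinM.
Qed.

Lemma has_intB f g I J : has_int f I -> has_int g J ->
  has_int (fun v => f v - g v) (I - J).
Proof.
move=> [If <-] [Ig <-]; split; last by rewrite RintegralB.
by have := integrableB (@measurable_half_line R) If Ig.
Qed.

Lemma has_int_le f g I J : has_int f I -> has_int g J ->
  (forall v, 0 < v -> `|f v| <= g v) -> `|I| <= J.
Proof.
move=> [If <-] [Ig <-] fg.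
apply: (le_trans (le_normr_Rintegral _ If)) => //.
apply: le_Rintegral => //.
  by have := integrable_abse If.
by move=> v; rewrite /= in_itv/= andbT; exact: fg.
Qed.

Lemma has_int_gmom k : has_int (fun v => v ^+ k * gauss6 v) (gmom k).
Proof. by split; [exact: integrable_gmom|rewrite gmomE]. Qed.

Lemma has_int_main n t : (0 < n)%N ->
  has_int (fun v => main_term n v * cosw t v)
    (27 * (1 - 24 * t ^+ 2 + 48 * t ^+ 4) * (expR (- (6 * t ^+ 2)) * gmom 0) /
     (180 * N n * (N n + 1))).
Proof.
move=> n0; set d := 180 * _ * _.
have H : has_int (fun v => v ^+ 4 * gauss6 v * cosw t v) (gmoment 4 (cosw t)).
  by split=> //; apply: integrable_gmoment (@norm_cosw _ t); exact: continuous_cosw.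
have := has_intZ d^-1 H.
rewrite gmoment4_cos gmoment0_cos mulrC.
by rewrite (_ : (fun v => _) = (fun v => main_term n v * cosw t v))//;
  apply/funext => v; rewrite /main_term -/d; ring.
Qed.

Lemma has_int_sincpow n t : (1 < n)%N ->
  has_int (fun v => sincpow n v * cosw t v)
    (\int[leb]_(v in D) (sincpow n v * cosw t v)).
Proof.
move=> n1; split=> //; have n0 : 0 < N n by rewrite ltr0n (leq_trans _ n1).
set r := Num.sqrt (N n); have r0 : 0 < r by rewrite sqrtr_gt0.
have l0 : 0 < r^-1 by rewrite invr_gt0.
have := integrable_sinc_wave (r * t) l0 n1.
apply: eq_integrable => // v _; rewrite /= /sinc_wave /sincpow /cosw -/r [v / r]mulrC.
by congr (_ * cos _)%:E; field; exact: lt0r_neq0.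
Qed.

Lemma has_int_cauchy n : (0 < n)%N ->
  has_int (fun v => N n / (N n + v ^+ 2)) (Num.sqrt (N n) * (pi / 2)).
Proof.
move=> n0; have N0 : 0 < N n by rewrite ltr0n.
have r0 : 0 < Num.sqrt (N n) by rewrite sqrtr_gt0.
have H := integral_atan r0; rewrite sqr_sqrtr ?(ltW N0)// in H.
have den v : 0 < N n + v ^+ 2 by rewrite ltr_pwDl// sqr_ge0.
have pos v : 0 <= N n / (N n + v ^+ 2) by rewrite divr_ge0// ltW.
split; last by rewrite /Rintegral H.
have c : continuous (fun v : R => N n + v ^+ 2) by continuous_auto.
apply/integrableP; split.
  apply/measurable_EFinP; apply: measurable_funTS; apply: continuous_measurable_fun.
  move=> v; apply: cvgM; first exact: cvg_cst.
  by apply: cvgV (c v); rewrite lt0r_neq0.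
rewrite [X in (X < _)%E](_ : _ = (Num.sqrt (N n) * (pi / 2))%:E) ?ltry//.
by rewrite -H; apply: eq_integral => v _ /=; rewrite ger0_norm.
Qed.

(* Bounds the error both for v ^ 2 <= n, where the moments of order 6 to 12 come
   from the expansion of sinc, and for v ^ 2 > n, where |sinc| <= 27 / 32. *)
Definition error_bound n v : R :=
  (N n ^+ 2 * (N n + 1))^-1 * ((14 * 100)^-1 * (v ^+ 6 * gauss6 v) +
    (100 * 100)^-1 * (v ^+ 8 * gauss6 v) + (400 * 400 * 100)^-1 * (v ^+ 10 * gauss6 v) +
    (100 * 100 * 100 * 100)^-1 * (v ^+ 12 * gauss6 v)) +
  2 * (27 / 32) ^+ (n - 2) * (N n / (N n + v ^+ 2) + N n.+1 / (N n.+1 + v ^+ 2)).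

Lemma sincpow_diff_le n v : (136 <= n)%N -> 0 < v ->
  `|sincpow n.+1 v - sincpow n v - main_term n v| <= error_bound n v.
Proof.
move=> n136 v0; have N136 : 136 <= N n by rewrite (ler_nat R 136).
have N0 : 0 < N n by lra.
have M0 : 0 < N n + 1 by lra.
set dn := N n ^+ 2 * (N n + 1).
have d0 : 0 < dn by rewrite /dn mulr_gt0 ?exprn_gt0.
have g0 := gauss6_ge0 v.
have v2 : 0 <= v ^+ 2 by exact: sqr_ge0.
have pw k : 0 <= v ^+ k * gauss6 v by rewrite mulr_ge0 ?exprn_ge0 ?(ltW v0).
have q0 : 0 <= (27 / 32 : R) ^+ (n - 2) by rewrite exprn_ge0.
have c0 k : 0 <= N k / (N k + v ^+ 2) by rewrite divr_ge0// addr_ge0.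
have t0 : 0 <= 2 * (27 / 32) ^+ (n - 2) * (N n / (N n + v ^+ 2) + N n.+1 / (N n.+1 + v ^+ 2)).
  by rewrite mulr_ge0 ?mulr_ge0 ?addr_ge0.
have h6 := pw 6%N; have h8 := pw 8%N; have h10 := pw 10%N; have h12 := pw 12%N.
rewrite /error_bound -/dn; have [vN|vN] := leP (v ^+ 2) (N n).
  rewrite -[leLHS]addr0 lerD// ler_pdivlMl// mulrC.
  apply: (le_trans (sincpow_diff_central n136 v0 vN)).
  by rewrite le_eqVlt; apply/orP; left; apply/eqP; field.
rewrite (le_trans (ler_normB _ _))// addrC lerD//.
  rewrite ler_pdivlMl// mulrC.
  apply: (le_trans (main_term_far n136 v0 vN)).
  by rewrite mulrA [gauss6 v * _]mulrC; lra.
rewrite (le_trans (ler_normB _ _))//.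
have := sincpow_far n136 (_ : n <= n <= n.+1)%N v0 vN; rewrite leqnn leqnSn => /(_ isT) hn.
have := sincpow_far n136 (_ : n <= n.+1 <= n.+1)%N v0 vN; rewrite leqnn leqnSn => /(_ isT) hm.
by apply: (le_trans (lerD hm hn)); rewrite le_eqVlt; apply/orP; left; apply/eqP; ring.
Qed.

(** With G = [gmom 0], the moments of order 6, 8, 10, 12 are 405, 8505, 229635 and 7577955 times G,
    so the Gaussian part is below 1.24 G; the tail is at most 8/110, absorbed through G >= 12/7. *)
Lemma has_int_error_bound n : (136 <= n)%N ->
  exists2 B, has_int (error_bound n) B & B * (N n ^+ 2 * (N n + 1)) < 9 / 5 * gmom 0.
Proof.
move=> n136; have N136 : 136 <= N n by rewrite (ler_nat R 136).
have N0 : 0 < N n by lra.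
have M0 : 0 < N n + 1 by lra.
set dn := N n ^+ 2 * (N n + 1).
have d0 : 0 < dn by rewrite /dn mulr_gt0 ?exprn_gt0.
have n0 : (0 < n)%N by apply: leq_trans n136.
have := has_intD
  (has_intZ dn^-1 (has_intD (has_intD (has_intD
     (has_intZ (14 * 100)^-1 (has_int_gmom 6)) (has_intZ (100 * 100)^-1 (has_int_gmom 8)))
     (has_intZ (400 * 400 * 100)^-1 (has_int_gmom 10)))
     (has_intZ (100 * 100 * 100 * 100)^-1 (has_int_gmom 12))))
  (has_intZ (2 * (27 / 32) ^+ (n - 2))
     (has_intD (has_int_cauchy n0) (has_int_cauchy (ltn0Sn n)))).
set B := (X in has_int _ X) => HB; exists B => //.
have := @gmom0_ge R.
rewrite /B !gmomS; move: (gmom 0) => G hG.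
have T := tail_small (R := R) n136.
set q := (27 / 32) ^+ (n - 2) in T *.
have q0 : 0 <= q by rewrite exprn_ge0.
(* Valid since n + 1 >= 121 = 11^2; it replaces the square roots by a polynomial bound. *)
have rM : Num.sqrt (N n.+1) <= (N n + 1) / 11.
  rewrite -natr1 -[leRHS]ger0_norm ?divr_ge0 ?(ltW M0)// -sqrtr_sqr ler_wsqrtr//.
  rewrite expr2.
  have : 0 <= (N n + 1) * (N n + 1 - 121) by rewrite mulr_ge0//; lra.
  by lra.
have rN : Num.sqrt (N n) <= (N n + 1) / 11.
  by apply: le_trans rM; rewrite ler_wsqrtr// ler_nat.
have pi4 : pi / 2 <= 2 :> R by have := @pihalf_lt2 R; lra.
have pi0 : 0 <= pi / 2 :> R by rewrite divr_ge0 ?pi_ge0.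
set p := pi / 2 in pi4 pi0 *.
have hr : Num.sqrt (N n) * p + Num.sqrt (N n.+1) * p <= 4 / 11 * (N n + 1).
  have h1 : Num.sqrt (N n) * p <= (N n + 1) / 11 * 2 by rewrite ler_pM ?sqrtr_ge0.
  have h2 : Num.sqrt (N n.+1) * p <= (N n + 1) / 11 * 2 by rewrite ler_pM ?sqrtr_ge0.
  by lra.
have hr0 : 0 <= Num.sqrt (N n) * p + Num.sqrt (N n.+1) * p.
  by rewrite addr_ge0// mulr_ge0 ?sqrtr_ge0.
move: (Num.sqrt (N n) * p + _) hr hr0 => s hs s0.
rewrite mulrDl mulrAC mulVf ?lt0r_neq0// mul1r.
have tail : 2 * q * s * dn <= 8 / 110.
  have dM : dn <= (N n + 1) ^+ 3.
    rewrite /dn (exprSr _ 2) ler_wpM2r ?(ltW M0)// lerXn2r ?nnegrE ?(ltW N0) ?(ltW M0)//; lra.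
  have sd : s * dn <= 4 / 11 * (N n + 1) * (N n + 1) ^+ 3.
    by apply: ler_pM => //; exact: ltW.
  have := ler_wpM2l q0 sd.
  rewrite (_ : q * (4 / 11 * (N n + 1) * (N n + 1) ^+ 3) = 4 / 11 * ((N n + 1) ^+ 4 * q)); last by ring.
  by move: T; move: ((N n + 1) ^+ 4 * q) => z T h; rewrite -!mulrA; move: h; move: (q * (s * dn)) => w h; lra.
by move: tail; move: (2 * q * s * dn) => w tail; lra.
Qed.

(* 9 / 5 = 12 * 27 / 180: only the term 12 of the numerator of Delta is needed. *)
Lemma integral_diff_close n t : (136 <= n)%N ->
  `|\int[leb]_(v in D) (sincpow n.+1 v * cosw t v) - \int[leb]_(v in D) (sincpow n v * cosw t v)
    - 27 * (1 - 24 * t ^+ 2 + 48 * t ^+ 4) * (expR (- (6 * t ^+ 2)) * gmom 0) /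
     (180 * N n * (N n + 1))| * (N n ^+ 2 * (N n + 1)) < 9 / 5 * gmom 0.
Proof.
move=> n136; have n1 : (1 < n)%N by apply: leq_trans n136.
have n0 : (0 < n)%N by apply: leq_trans n136.
have N0 : 0 < N n by rewrite ltr0n.
have M0 : 0 < N n + 1 by lra.
have d0 : 0 < N n ^+ 2 * (N n + 1) by rewrite mulr_gt0 ?exprn_gt0.
have [B HB Bs] := has_int_error_bound n136.
apply: le_lt_trans Bs; rewrite ler_wpM2r ?(ltW d0)//.
have H := has_intB (has_intB (has_int_sincpow t (leqW n1)) (has_int_sincpow t n1)) (has_int_main t n0).
apply: (has_int_le H HB) => v v0.
rewrite -!mulrBl normrM; apply: le_trans (sincpow_diff_le n136 v0).
by rewrite ler_piMr// norm_cosw// ltW.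
Qed.

Definition quartic (t : R) : R := 1 - 24 * t ^+ 2 + 48 * t ^+ 4.

Lemma quartic_factor t :
  quartic t = 48 * (t ^+ 2 - gamma_minus ^+ 2) * (t ^+ 2 - gamma_plus ^+ 2) /\
  0 <= (gamma_minus : R) <= gamma_plus.
Proof.
have w2 : Num.sqrt (2 / 3) ^+ 2 = 2 / 3 :> R by rewrite sqr_sqrtr.
have w0 : 0 <= Num.sqrt (2 / 3) :> R by rewrite sqrtr_ge0.
have w1 : Num.sqrt (2 / 3) <= 1 :> R.
  by rewrite -[leRHS]sqrtr1 ler_wsqrtr//; lra.
rewrite /gamma_minus /gamma_plus /quartic; move: (Num.sqrt (2 / 3)) w2 w0 w1 => w w2 w0 w1.
split.
  rewrite !exprMn !sqr_sqrtr; [|lra|lra].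
  have : w ^+ 2 = 2 / 3 by [].
  by lra.
rewrite mulr_ge0 ?sqrtr_ge0//= ler_wpM2l// ler_wsqrtr//; lra.
Qed.

Lemma quartic_gt0 t : 0 <= t -> (0 <= t < gamma_minus) || (gamma_plus < t) -> 0 < quartic t.
Proof.
have [-> /andP[g0 gg]] := quartic_factor t => t0 /orP[/andP[_ tg]|tg].
  have h1 : t ^+ 2 < gamma_minus ^+ 2 by rewrite ltrXn2r.
  have h2 : gamma_minus ^+ 2 <= gamma_plus ^+ 2 :> R by rewrite lerXn2r ?nnegrE// (le_trans g0).
  have : 0 < (gamma_minus ^+ 2 - t ^+ 2) * (gamma_plus ^+ 2 - t ^+ 2) by rewrite mulr_gt0//; lra.
  by lra.
have gp0 := le_trans g0 gg.
have h1 : gamma_plus ^+ 2 < t ^+ 2 by rewrite ltrXn2r.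
have h2 : gamma_minus ^+ 2 <= gamma_plus ^+ 2 :> R by rewrite lerXn2r ?nnegrE// (le_trans g0).
have : 0 < (t ^+ 2 - gamma_minus ^+ 2) * (t ^+ 2 - gamma_plus ^+ 2) by rewrite mulr_gt0//; lra.
by lra.
Qed.

Lemma quartic_lt0 t : gamma_minus < t < gamma_plus -> quartic t < 0.
Proof.
have [-> /andP[g0 gg]] := quartic_factor t => /andP[gt tg].
have t0 := le_trans g0 (ltW gt).
have h1 : gamma_minus ^+ 2 < t ^+ 2 by rewrite ltrXn2r.
have h2 : t ^+ 2 < gamma_plus ^+ 2 by rewrite ltrXn2r.
have : 0 < (t ^+ 2 - gamma_minus ^+ 2) * (gamma_plus ^+ 2 - t ^+ 2) by rewrite mulr_gt0//; lra.
by lra.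
Qed.

Lemma section_volume_sincpow k t : 0 <= t ->
  section_volume k.+2 t = 2 / pi * \int[leb]_(v in D) (sincpow k.+2 v * cosw t v).
Proof. by move=> t0; rewrite section_volume_sinc. Qed.

Lemma section_volume_diff_sign n t : 0 <= t -> quartic t != 0 -> Delta t <= n%:R ->
  (0 < quartic t -> 0 < section_volume n.+1 t - section_volume n t) /\
  (quartic t < 0 -> section_volume n.+1 t - section_volume n t < 0).
Proof.
move=> t0 p0; rewrite /Delta ge_max -/(quartic t) => /andP[n136 nD].
have {}n136 : (136 <= n)%N by rewrite -(ler_nat R).
have close := integral_diff_close t n136.
(* n >= 136 excludes 0 and 1, so both volumes are in the range of the Fourier formula. *)
case: n => [|[|k]] // in n136 nD close *.
rewrite !section_volume_sincpow// -mulrBr.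
move: close; set n := k.+2; set I := _ - \int[leb]_(v in D) _.
rewrite -/(quartic t); set p := quartic t in p0 nD *; set G := gmom 0.
have N136 : 136 <= N n by rewrite (ler_nat R 136).
have N0 : 0 < N n by lra.
have M0 : 0 < N n + 1 by lra.
have Nn := lt0r_neq0 N0; have Mn := lt0r_neq0 M0.
have G0 : 0 < G by have := @gmom0_ge R; rewrite -/G; lra.
have pp : 0 < `|p| by rewrite normr_gt0.
set E := expR (- (6 * t ^+ 2)).
have E0 : 0 < E by exact: expR_gt0.
(* [Delta t <= n] multiplied by |p| e^(-6 t^2), the numerator being at least its constant term as t
   >= 0. *)
have key : 12 <= `|p| * E * N n.
  have h : 12 <= 12 + 10 * t + 7 * t ^+ 2 + 10 * t ^+ 3.
    have h2 := sqr_ge0 t; have h3 : 0 <= t ^+ 3 by rewrite exprn_ge0.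
    by lra.
  apply: (le_trans h).
  have := ler_wpM2l (ltW (mulr_gt0 pp E0)) nD.
  rewrite (_ : _ * _ * _ = 12 + 10 * t + 7 * t ^+ 2 + 10 * t ^+ 3)//.
  rewrite /E expRN; have := lt0r_neq0 pp; have := lt0r_neq0 (expR_gt0 (6 * t ^+ 2)).
  by move: (expR _) `|p| => X P X0 P0; field; rewrite X0 P0.
(* 9/5 = 12 * 3/20, and 3/20 = 27/180 is the coefficient of the main term once multiplied by n^2 (n
   + 1); the strict error bound then fixes the sign. *)
have keyG : 9 / 5 * G <= 3 / 20 * (`|p| * E * N n) * G.
  by rewrite ler_wpM2r ?(ltW G0)//; lra.
have d0 : 0 < N n ^+ 2 * (N n + 1) by rewrite mulr_gt0 ?exprn_gt0.
rewrite -[X in _ * X](gtr0_norm d0) -normrM mulrBl.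
rewrite (_ : 27 * p * _ / _ * (N n ^+ 2 * (N n + 1)) = 3 / 20 * (p * E * N n) * G); last first.
  by field; rewrite Nn Mn.
have c0 : 0 < 2 / pi :> R by rewrite divr_gt0 ?pi_gt0.
rewrite ltr_norml => /andP[l1 l2]; split=> ps.
  rewrite (gtr0_norm ps) in keyG.
  rewrite mulr_gt0// -(pmulr_lgt0 _ d0).
  by move: l1 keyG; move: (3 / 20 * _ * G) (I * _) => a b; lra.
rewrite (ltr0_norm ps) in keyG.
rewrite pmulr_rlt0// -(pmulr_llt0 _ d0).
have keyG' : 9 / 5 * G <= - (3 / 20 * (p * E * N n) * G).
  by apply: (le_trans keyG); rewrite le_eqVlt; apply/orP; left; apply/eqP; ring.
by move: l2 keyG'; move: (3 / 20 * _ * G) (I * _) => a b; lra.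
Qed.

End assembly.

Theorem theorem4p1 (R : realType) (t : R) (d : nat) :
  0 <= t -> t <> gamma_minus -> t <> gamma_plus ->
  Delta t <= d%:R ->
  ((0 <= t < gamma_minus) || (gamma_plus < t) ->
     0 < section_volume d.+1 t - section_volume d t) /\
  (gamma_minus < t < gamma_plus ->
     section_volume d.+1 t - section_volume d t < 0).
Proof.
move=> t0 _ _ dD; split=> ht.
  have p0 := quartic_gt0 t0 ht.
  by have [] := section_volume_diff_sign t0 (lt0r_neq0 p0) dD; auto.
have p0 := quartic_lt0 ht.
by have [] := section_volume_diff_sign t0 (ltr0_neq0 p0) dD; auto.
Qed.
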